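(* Let $g\ge1$, $s\in\{0,1,\dots,2g+2\}$ and integers $p,q\ge0$ with $p-q=g+1-s$. Let $i_1,\dots,i_{2g+2},j_1,\dots,j_{g-1}\in I\setminus K$ and $0,k_1,\dots,k_p,l_1,\dots,l_q\in K$, where the indices $i_1,\dots,i_{2g+2},k_1,\dots,k_p,l_1,\dots,l_q$ are pairwise different (and different from $0$). Put $$P=(0k_1)\cdots(0k_p),\quad Q=(0l_1)\cdots(0l_q),\quad U=(0j_1)\cdots(0j_{g-1}),$$ $$r=(0i_1)\cdots(0i_s)P^2-(0i_{s+1})\cdots(0i_{2g+2})Q^2,$$ a form of degree $k:=s+2p=p+q+g+1$ in $x=x_0,y=y_0$. Let $(X_i,Y_i)$, $i=1,\dots,k$, be the homogeneous coordinates of the linear factors of $r$, i.e. $r=C\prod_{i=1}^k(xY_i-yX_i-hyY_i)$, and let $$dh_{X_i,Y_i}=(W^{(i)})^{-1}\,(X_ij_1)\cdots(X_ij_{g-1})\,(dX_i,X_i),\qquad W^{(i)}=\sqrt{(X_ii_1)\cdots(X_ii_{2g+2})},$$ be the associated hyperelliptic differentials of the first kind. Then $$\epsilon_1\,dh_{X_1,Y_1}+\dots+\epsilon_k\,dh_{X_k,Y_k}=0$$ with certain $\epsilon_i=\pm1$.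
   Context: Fix $h\in\mathbb C$, $h\neq0$. $U_h(sl(2))$ is the complex unital Hopf algebra with generators $E,F,H$, relations $[H,E]=E\cosh(hF)+\cosh(hF)E$, $[H,F]=-\frac2h\sinh(hF)$, $[E,F]=H$, and coproduct $\Delta(E)=E\otimes e^{-hF}+e^{hF}\otimes E$, $\Delta(F)=F\otimes1+1\otimes F$, $\Delta(H)=H\otimes e^{-hF}+e^{hF}\otimes H$. For a totally ordered index set $I$, $H_I$ is the unital complex algebra with generators $x_i,y_i$ ($i\in I$) and relations $x_iy_i=y_ix_i+hy_i^2$ and, for $i<j$, $x_jy_i=y_ix_j+hy_iy_j$, $y_jx_i=x_iy_j-hy_iy_j$, $y_jy_i=y_iy_j$, $x_jx_i=x_ix_j-hx_iy_j+hy_ix_j+h^2y_iy_j$. It is a $U_h(sl(2))$-module algebra via $Hx_i=x_i$, $Hy_i=-y_i$, $Ex_i=0$, $Ey_i=x_i$, $Fx_i=y_i$, $Fy_i=0$, $E1=F1=H1=0$ and the Leibniz rules given by the coproduct. $H_I$ is a domain with right quotient division ring $Q_I$, to which the action extends. Invariant elements $v$ are those with $Ev=Fv=Hv=0$ (superscript $Inv$). The brackets $(ij)=x_iy_j-y_ix_j-hy_iy_j$ are invariant and central in $H_I$. $H_J$, $Q_J$ denote the subalgebras belonging to $J\subseteq I$. Let $0\in I$, $x=x_0$, $y=y_0$. Decomposition of forms. An $n$-form is a nonzero invariant element $f=\sum_i x^{n-i}y^iA_i$ with $A_i\in H_{I\setminus\{0\}}$. Let $a\in I$ be an auxiliary index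 ($a\ne0$) whose variables do not occur in $f$. Let $\Delta_{kl}$ be the derivation of $H_I$ with $x_k\mapsto x_l$, $y_k\mapsto y_l$, all other generators $\mapsto0$, and $P_{kl}=\frac1m\Delta_{kl}$ on elements homogeneous of degree $m$ in the index $k$. Put $f_a=P_{0a}^nf$, $\xi=P_{0a}^{n-1}f=x\delta-y\gamma-hy\delta$ with $\gamma,\delta\in H_{I\setminus\{0\}}$, $\eta=(0a)$. There are invariant $u_i\in H_{I\setminus\{0\}}$ with $f=f_a^{-n}\sum_i\xi^{n-i}\eta^iu_i$; in a commutative splitting field $\Sigma\supset Q^{Inv}_{I\setminus\{0\}}$ one writes $f=C\prod_i(\xi-\sigma_i\eta)$ with $C=f_a^{1-n}\in Q^{Inv}_{I\setminus\{0\}}$. The $\sigma_i$ are taken to be invariant and to commute with $Q_I$ and each other, and $Q_I^\Sigma=Q_I[\sigma_1,\dots,\sigma_n]$, $Q^\Sigma_{I\setminus\{0\}}=Q_{I\setminus\{0\}}[\sigma_1,\dots,\sigma_n]$ are the central skew field extensions. Then $f=C\prod_{i=1}^n(xY_i-yX_i-hyY_i)$ with $X_i=\gamma-\sigma_ix_a$, $Y_i=\delta-\sigma_iy_a\in Q^\Sigma_{I\setminus\{0\}}$; $(X_i,Y_i)$ are called the homogeneous coordinates of the linear factors of $f$, and $Z_i=X_iY_i^{-1}+\frac h2$. In the claim this is applied to $f=r$, $n=k$. Notation: $(X_ij):=X_iy_j-Y_ix_j-hY_iy_j$ for $j\in I$. $Q_I^{\Sigma,W}$ is the skew field obtained from $Q_I^\Sigma$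 by adjoining central root elements $W^{(i)}$ with $(W^{(i)})^2=(X_ii_1)\cdots(X_ii_{2g+2})$, $i=1,\dots,k$. Differentials. $K\subseteq I$ is a fixed subset with $0\in K$. $\Gamma_{I,K}=Q_Id_KQ_I$ is the $Q_I$-bimodule generated by symbols $dx_j,dy_j$ ($j\in K$) with relations, for $i\in I$, $j\in K$, $dx_j\cdot x_i=x_idx_j-hx_idy_j+hy_idx_j+h^2y_idy_j$, $dy_j\cdot y_i=y_idy_j$, $dx_j\cdot y_i=y_idx_j+hy_idy_j$, $dy_j\cdot x_i=x_idy_j-hy_idy_j$. The total differential $d=d_K:Q_I\to\Gamma_{I,K}$ is the linear map with $d(x_i)=dx_i$, $d(y_i)=dy_i$ for $i\in K$, $d(x_i)=d(y_i)=0$ for $i\in I\setminus K$, and $d(ab)=da\cdot b+a\,db$. For a central extension $S=Q_I[\sigma_1,\dots]$ the differential module $Sd_KS$ is defined analogously, with the additional requirements given by the (differentiated) defining relations of the adjoined elements $\sigma$ and the conditions $\sigma\,dt-dt\cdot\sigma=0$ and $t\,d\sigma-d\sigma\cdot t=0$ for $t\in S$. The claimed identity holds in the differential module $Q_I^{\Sigma,W}d_KQ_I^{\Sigma,W}$. Finally $(dX_i,X_i):=dX_i\cdot Y_i-dY_i\cdot X_i-h\,dY_i\cdot Y_i=Y_i^2\,dZ_i$. *)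

(* Defs.v *)
From HB Require Import structures.
From mathcomp Require Import all_boot all_order all_algebra.
From mathcomp Require Import complex classical_sets reals.

Set Implicit Arguments.
Unset Strict Implicit.
Unset Printing Implicit Defensive.

Import Order.TTheory GRing.Theory Num.Theory.

Local Open Scope classical_set_scope.
Local Open Scope ring_scope.
Local Open Scope complex_scope.

Section Algebras.
Variable R : realType.
Local Notation C := R[i].

Inductive subalg (A : algType C) (G : set A) : set A :=
| subalg_gen a of G a : subalg G a
| subalg_scalar (c : C) : subalg G c%:A
| subalg_add a b of subalg G a & subalg G b : subalg G (a + b)
| subalg_mul a b of subalg G a & subalg G b : subalg G (a * b).

Definition is_skew_field (A : unitAlgType C) : Prop :=
  forall a : A, a != 0 -> a \is a GRing.unit.

Definition right_quotient_skew_field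
    (A : algType C) (Q : unitAlgType C) (j : {lrmorphism A -> Q}) : Prop :=
  [/\ is_skew_field Q, injective j
    & forall q : Q, exists a b : A, b != 0 /\ q = j a / j b].

(* [B] is a skew field, generated as a ring by [A] and the central elements
   [t i]:  B = A[t_1, ..., t_n]. *)
Definition central_skew_extension (A B : unitAlgType C)
    (iota : {lrmorphism A -> B}) (n : nat) (t : 'I_n -> B) : Prop :=
  [/\ is_skew_field B,
      forall i b, t i * b = b * t i
    & forall b, subalg [set z | (exists a, z = iota a) \/
                                (exists i, z = t i)] b].

(* (X Y | X' Y') = X Y' - Y X' - h Y Y'.  The bracket (ij) is the case
   (X, Y) = (x_i, y_i), (X', Y') = (x_j, y_j). *)
Definition bracket (A : algType C) (h : C) (X Y X' Y' : A) : A :=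
  X * Y' - Y * X' - h *: (Y * Y').

End Algebras.

Section TheAlgebraHI.
Variables (R : realType) (h : R[i]).
Variables (disp : Order.disp_t) (I : orderType disp).
Local Notation C := R[i].

Definition HI_relations (A : algType C) (x y : I -> A) : Prop :=
  (forall i, x i * y i = y i * x i + h *: (y i * y i)) /\
  (forall i j, (i < j)%O ->
    [/\ x j * y i = y i * x j + h *: (y i * y j),
        y j * x i = x i * y j - h *: (y i * y j),
        y j * y i = y i * y j
      & x j * x i = x i * x j - h *: (x i * y j) + h *: (y i * x j)
                    + h ^+ 2 *: (y i * y j)]).

Definition gens (A : algType C) (x y : I -> A) (J : set I) : set A :=
  [set a | exists2 i, J i & a = x i \/ a = y i].

(* [A] is the unital algebra presented by the generators x_i, y_i and the
   relations [HI_relations]. *)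
Definition is_HI (A : algType C) (x y : I -> A) : Prop :=
  [/\ HI_relations x y,
      forall a, subalg (gens x y setT) a
    & forall (B : algType C) (x' y' : I -> B), HI_relations x' y' ->
        exists phi : {lrmorphism A -> B},
          forall i, phi (x i) = x' i /\ phi (y i) = y' i].

Definition HJ (A : algType C) (x y : I -> A) (J : set I) : set A :=
  subalg (gens x y J).

(* Q_J, as the set of right fractions of H_J inside Q_I *)
Definition QJ (A : algType C) (Q : unitAlgType C) (j : {lrmorphism A -> Q})
    (x y : I -> A) (J : set I) : set Q :=
  [set q | exists a b : A,
     [/\ HJ x y J a, HJ x y J b, b != 0 & q = j a / j b]].

End TheAlgebraHI.

Section Action.
Variables (R : realType) (h : R[i]).
Local Notation C := R[i].

(* A U_h(sl(2))-module algebra.  Besides the operators E, F, H we record the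
   operators K = e^{hF} and K' = e^{-hF}.  They are the exponential series
   wherever it terminates, in particular on all of H_I, where F is locally
   nilpotent.  On the quotient skew field the series need not terminate, and
   e^{hF} is the extension of the automorphism e^{hF} of H_I. *)
Record Uh_module_algebra (A : algType C) := UhModuleAlgebra {
  opE : {linear A -> A};
  opF : {linear A -> A};
  opH : {linear A -> A};
  opK : {linear A -> A};
  opK' : {linear A -> A};
  opcosh := fun v : A => 2^-1 *: (opK v + opK' v);
  opsinh := fun v : A => 2^-1 *: (opK v - opK' v);
  opK_exp : forall N v, iter N opF v = 0 ->
    opK v = \sum_(m < N) (h ^+ m / m`!%:R) *: iter m opF v;
  opK'_exp : forall N v, iter N opF v = 0 ->
    opK' v = \sum_(m < N) ((- h) ^+ m / m`!%:R) *: iter m opF v;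
  opKK' : forall v, opK (opK' v) = v;
  opK'K : forall v, opK' (opK v) = v;
  opKF : forall v, opK (opF v) = opF (opK v);
  opHE : forall v, opH (opE v) - opE (opH v) =
                   opE (opcosh v) + opcosh (opE v);
  opHF : forall v, opH (opF v) - opF (opH v) = - (2 / h) *: opsinh v;
  opEF : forall v, opE (opF v) - opF (opE v) = opH v;
  opE1 : opE 1 = 0;
  opF1 : opF 1 = 0;
  opH1 : opH 1 = 0;
  opK1 : opK 1 = 1;
  opEM : forall a b, opE (a * b) = opE a * opK' b + opK a * opE b;
  opFM : forall a b, opF (a * b) = opF a * b + a * opF b;
  opHM : forall a b, opH (a * b) = opH a * opK' b + opK a * opH b;
  opKM : forall a b, opK (a * b) = opK a * opK b
}.

Definition invariant (A : algType C) (U : Uh_module_algebra A) (v : A) : Prop :=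
  [/\ opE U v = 0, opF U v = 0 & opH U v = 0].

Definition action_extends (A B : algType C) (phi : {lrmorphism A -> B})
    (U : Uh_module_algebra A) (V : Uh_module_algebra B) : Prop :=
  forall a, [/\ opE V (phi a) = phi (opE U a), opF V (phi a) = phi (opF U a),
                opH V (phi a) = phi (opH U a), opK V (phi a) = phi (opK U a)
              & opK' V (phi a) = phi (opK' U a)].

Definition is_HI_action (disp : Order.disp_t) (I : orderType disp)
    (A : algType C) (x y : I -> A) (U : Uh_module_algebra A) : Prop :=
  forall i, [/\ opH U (x i) = x i, opH U (y i) = - y i,
                opE U (x i) = 0 & opE U (y i) = x i] /\
            (opF U (x i) = y i /\ opF U (y i) = 0).

End Action.

Section Forms.
Variables (R : realType) (h : R[i]).
Variables (disp : Order.disp_t) (I : orderType disp).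
Local Notation C := R[i].
Variables (A : algType C) (x y : I -> A) (U : Uh_module_algebra h A).
Variable o : I. (* the distinguished index 0 *)

Definition is_form (n : nat) (f : A) : Prop :=
  [/\ f != 0, invariant U f
    & exists c : 'I_n.+1 -> A, (forall i, HJ x y (~` [set o]) (c i)) /\
        f = \sum_(i < n.+1) x o ^+ (n - i) * y o ^+ i * c i].

Definition is_Delta (k l : I) (D : {linear A -> A}) : Prop :=
  [/\ forall a b, D (a * b) = D a * b + a * D b,
      D (x k) = x l /\ D (y k) = y l
    & forall i, i != k -> D (x i) = 0 /\ D (y i) = 0].

(* P_{kl}^m f for f homogeneous of degree n in the index k, where
   D = Delta_{kl} and P_{kl} = D / (degree in the index k). *)
Fixpoint polar (D : A -> A) (n m : nat) (f : A) : A :=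
  if m is m'.+1 then (n - m')%:R^-1 *: D (polar D n m' f) else f.

Variables (Q : unitAlgType C) (j : {lrmorphism A -> Q}).
Variable UQ : Uh_module_algebra h Q.
Variables (S : unitAlgType C) (iota : {lrmorphism Q -> S}).
Variable US : Uh_module_algebra h S.

(* The decomposition of an n-form f into linear factors, with auxiliary index
   a: [S] is the skew field Q_I^Sigma, [Sigma] the splitting field with its
   embedding [kappa] into the center of Q_I^Sigma, [sigma] the family of the
   sigma_i, and [gam], [del], [u] are the elements gamma, delta, u_i of
   H_{I\{0}}. *)
Record factor_data (n : nat) (f : A) (a : I) (D : {linear A -> A})
    (gam del : A) (u : 'I_n.+1 -> A)
    (Sigma : fieldType) (kappa : {rmorphism Sigma -> S})
    (sigma : 'I_n -> Sigma) : Prop := FactorData {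
  fd_n_gt0 : (0 < n)%N;
  fd_a_neq0 : a != o;
  fd_a_aux : HJ x y (~` [set a]) f;
  fd_D : is_Delta o a D;
  fd_gam : HJ x y (~` [set o]) gam;
  fd_del : HJ x y (~` [set o]) del;
  fd_xi : polar D n n.-1 f = bracket h (x o) (y o) gam del;
  fd_u : forall i, HJ x y (~` [set o]) (u i) /\ invariant U (u i);
  fa := j (polar D n n f);
  xi := j (polar D n n.-1 f);
  eta := j (bracket h (x o) (y o) (x a) (y a));
  Cf := fa ^- n.-1;
  fd_f_u : j f = fa ^- n * \sum_(i < n.+1) xi ^+ (n - i) * eta ^+ i * j (u i);
  fd_Sigma_inv : forall v, QJ j x y (~` [set o]) v -> invariant UQ v ->
    exists c, kappa c = iota v;
  fd_Sigma_central : forall c s, kappa c * s = s * kappa c;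
  (* splitting of the binary form f = fa^-n \sum_i xi^(n-i) eta^i u_i, written
     in the indeterminate 'X = xi / eta *)
  fd_split : \sum_(i < n.+1) (iota (fa ^- n * j (u i)))%:P * 'X^(n - i) =
             (iota Cf)%:P * \prod_(i < n) ('X - (kappa (sigma i))%:P);
  fd_factors : iota (j f) =
             iota Cf * \prod_(i < n) (iota xi - kappa (sigma i) * iota eta);
  fd_sigma_inv : forall i, invariant US (kappa (sigma i));
  fd_ext : central_skew_extension iota (fun i => kappa (sigma i))
}.

(* The homogeneous coordinates X_i = gamma - sigma_i x_a,
   Y_i = delta - sigma_i y_a of a linear factor, for s = sigma_i in S.  As
   sigma_i is central, xi - sigma_i eta = x Y_i - y X_i - h y Y_i. *)
Definition coordX (gam : A) (a : I) (s : S) : S :=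
  iota (j gam) - s * iota (j (x a)).
Definition coordY (del : A) (a : I) (s : S) : S :=
  iota (j del) - s * iota (j (y a)).

End Forms.

Section Differentials.
Variables (R : realType) (h : R[i]).
Variables (disp : Order.disp_t) (I : orderType disp).
Local Notation C := R[i].
Variable S : algType C.

(* An S-bimodule (with the two actions of C agreeing) is a left module [M]
   together with a right multiplication [rm]. *)
Record is_bimodule (M : lmodType S) (rm : M -> S -> M) : Prop := IsBimodule {
  rmDl : forall m m' s, rm (m + m') s = rm m s + rm m' s;
  rmDr : forall m s t, rm m (s + t) = rm m s + rm m t;
  rm1 : forall m, rm m 1 = m;
  rmA : forall m s t, rm (rm m s) t = rm m (s * t);
  rmZ : forall s m t, rm (s *: m) t = s *: rm m t;
  rmC : forall m (c : C), rm m c%:A = c%:A *: m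
}.

Variables (x y : I -> S) (K : set I).
Variable T : set S. (* the adjoined central elements *)

Record differential_relations (M : lmodType S) (rm : M -> S -> M)
    (d : S -> M) : Prop := DifferentialRelations {
  dr_bimodule : is_bimodule rm;
  dr_add : forall s t, d (s + t) = d s + d t;
  dr_scale : forall (c : C) s, d (c *: s) = c%:A *: d s;
  dr_leibniz : forall s t, d (s * t) = rm (d s) t + s *: d t;
  dr_const : forall i, ~ K i -> d (x i) = 0 /\ d (y i) = 0;
  dr_xx : forall i j, K j -> rm (d (x j)) (x i) =
    x i *: d (x j) - (h *: x i) *: d (y j) + (h *: y i) *: d (x j)
    + (h ^+ 2 *: y i) *: d (y j);
  dr_yy : forall i j, K j -> rm (d (y j)) (y i) = y i *: d (y j);
  dr_xy : forall i j, K j -> rm (d (x j)) (y i) =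
    y i *: d (x j) + (h *: y i) *: d (y j);
  dr_yx : forall i j, K j -> rm (d (y j)) (x i) =
    x i *: d (y j) - (h *: y i) *: d (y j);
  dr_central_l : forall s t, T s -> s *: d t = rm (d t) s;
  dr_central_r : forall s t, T s -> t *: d s = rm (d s) t
}.

(* The differential module S d_K S with its total differential [d]: the
   bimodule generated by the dx_j, dy_j (j in K) and the ds (s in T), subject
   to the relations above.  The differentiated defining relations of the
   adjoined elements are the consequences of [d] being a derivation on S. *)
Record is_differential_module (M : lmodType S) (rm : M -> S -> M)
    (d : S -> M) : Prop := IsDifferentialModule {
  dm_relations : differential_relations rm d;
  dm_generated : forall P : set M,
    P 0 -> (forall m m', P m -> P m' -> P (m + m')) ->
    (forall s m, P m -> P (s *: m)) -> (forall s m, P m -> P (rm m s)) ->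
    (forall i, K i -> P (d (x i)) /\ P (d (y i))) ->
    (forall s, T s -> P (d s)) ->
    forall m, P m;
  dm_universal : forall (M' : lmodType S) (rm' : M' -> S -> M') (d' : S -> M'),
    differential_relations rm' d' ->
    exists phi : {linear M -> M'},
      (forall m s, phi (rm m s) = rm' (phi m) s) /\
      (forall s, phi (d s) = d' s)
}.

(* (dX, X) *)
Definition dbracket (M : lmodType S) (rm : M -> S -> M) (d : S -> M)
    (X Y : S) : M :=
  rm (d X) Y - rm (d Y) X - h%:A *: rm (d Y) Y.

End Differentials.

(* dh_{X,Y} = W^{-1} (X j_1) ... (X j_{g-1}) (dX, X) *)
Definition hyperelliptic_differential (R : realType) (h : R[i])
    (S : unitAlgType R[i]) (M : lmodType S) (rm : M -> S -> M) (d : S -> M)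
    (m : nat) (xj yj : 'I_m -> S) (W X Y : S) : M :=
  (W^-1 * \prod_(n < m) bracket h X Y (xj n) (yj n)) *: dbracket h rm d X Y.

(* r = (0 i_1) ... (0 i_s) P^2 - (0 i_{s+1}) ... (0 i_N) Q^2, the index i_{m+1}
   being [i_ m] *)
Definition abel_form (R : realType) (h : R[i])
    (disp : Order.disp_t) (I : orderType disp)
    (A : algType R[i]) (x y : I -> A) (o : I) (N s p q : nat)
    (i_ : 'I_N -> I) (k_ : 'I_p -> I) (l_ : 'I_q -> I) : A :=
  let br i := bracket h (x o) (y o) (x i) (y i) in
  (\prod_(m < N | (m < s)%N) br (i_ m)) * (\prod_(m < p) br (k_ m)) ^+ 2
  - (\prod_(m < N | (s <= m)%N) br (i_ m)) * (\prod_(m < q) br (l_ m)) ^+ 2.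

(* Main.v *)
(* Every bracket (ij) is central, and its differential is central as well; hence
   the central elements of Q_I^{Sigma,W} whose differential commutes with
   everything form a commutative field F with a derivation, which contains the
   brackets, the sigma_i and the W^(i).  By the Pluecker relation
   (ab) p_c = (cb) p_a + (ac) p_b for p_i = (x_i, y_i), every point is an
   F-linear combination of two fixed points p_1, p_2 with indices outside K, and
   so are the homogeneous coordinates (X_i, Y_i).  In these coordinates the
   claim is Abel's theorem over F: at a root t_i of A P^2 - B Q^2 one has
   sqrt(A B) = +- A P / Q, and sum_i U Q / (A P) (t_i) d t_i is a sum of residues
   which vanishes for degree reasons, the coefficients of A and B being constant.

   The factorisation of r is transported by the algebra morphisms on H_I which
   move the point p_0.  That r and the brackets do not vanish is seen in a
   representation of H_I by differential operators in which all brackets are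
   scalars. *)
Require Import Defs.
From HB Require Import structures.
From mathcomp Require Import all_boot all_order all_algebra.
From mathcomp Require Import complex classical_sets reals.
From mathcomp Require Import boolp functions ring zify.

Set Implicit Arguments.
Unset Strict Implicit.
Unset Printing Implicit Defensive.

Import Order.TTheory GRing.Theory Num.Theory.

Local Open Scope classical_set_scope.
Local Open Scope ring_scope.
Local Open Scope complex_scope.

(** * Abel's identity over a differential field *)

(** Three points shape the argument. The roots [t_i] are not known to be distinct, so one cannot
    solve for [d t_i] by dividing by the derivative of the polynomial; the sum of residues is
    therefore replaced by a linear functional, the top coefficient of the remainder modulo the
    polynomial, which makes sense for multiple roots too. The factorisation of r is given only at
    the single point [p_0], while Abel's theorem needs it as an identity of polynomials, that is, at
    every point; since [f_a] and the [u_i] do not involve the index 0, multiplying by a power of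
    [f_a] gives an identity in [H_I] in which [p_0] may be replaced by any point with the same
    relations. Finally, the fixed points [p_1], [p_2] are chosen among the [i_m]: they are constant,
    and r does not vanish at [p_2], so that no root lies at infinity. The root elements [W^(i)] are
    known only through their squares, which is where the signs come from. *)

Section AbelIdentity.
Variables (F : fieldType) (V : lmodType F) (dif : F -> V).
Hypothesis difD : forall a b, dif (a + b) = dif a + dif b.
Hypothesis difM : forall a b, dif (a * b) = a *: dif b + b *: dif a.

Lemma dif0 : dif 0 = 0.
Proof. by apply: (@addrI _ (dif 0)); rewrite -difD !addr0. Qed.

Lemma dif1 : dif 1 = 0.
Proof.
by apply: (@addrI _ (dif 1)); rewrite addr0 -[in RHS](mulr1 1) difM !scale1r.
Qed.

Lemma difN a : dif (- a) = - dif a.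
Proof. by apply/eqP; rewrite -subr_eq0 opprK -difD addNr dif0. Qed.

Lemma dif_sum I (r : seq I) P E :
  dif (\sum_(i <- r | P i) E i) = \sum_(i <- r | P i) dif (E i).
Proof. by apply: (big_morph dif difD dif0). Qed.

Lemma dif_div a b : b != 0 -> dif (a / b) = b ^- 2 *: (b *: dif a - a *: dif b).
Proof.
move=> b0; have E : dif (b * b^-1) = 0 by rewrite divff // dif1.
have {E} E : dif b^-1 = - (b ^- 2) *: dif b.
  apply: (scalerI b0); move/eqP: E; rewrite difM addr_eq0 => /eqP ->.
  by rewrite !scalerA mulrN exprS invfM mulrA mulfV // mul1r expr1 scaleNr.
rewrite difM E scalerBr !scalerA addrC expr2; congr (_ *: _ + _).
  by field.
by rewrite -scaleNr; congr (_ *: _); ring.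
Qed.

Definition difconst (p : {poly F}) := forall i, dif p`_i = 0.

Lemma difconst1 : difconst 1.
Proof. by move=> i; rewrite coef1; case: (i == 0)%N; rewrite ?dif0 ?dif1. Qed.

Lemma difconstM p q : difconst p -> difconst q -> difconst (p * q).
Proof.
move=> dp dq i; rewrite coefM dif_sum big1 // => m _.
by rewrite difM dp dq !scaler0 addr0.
Qed.

Lemma difconst_linear a b : dif a = 0 -> dif b = 0 -> difconst (a%:P + b *: 'X).
Proof.
move=> da db i; rewrite coefD coefC coefZ coefX difD difM db scaler0 addr0.
by case: i => [|[|i]] //=; rewrite ?dif0 ?dif1 ?da ?scaler0 ?addr0.
Qed.

Variable T : {poly F} -> F.
Hypothesis TD : forall p q, T (p + q) = T p + T q.
Hypothesis TZ : forall c p, T (c *: p) = c * T p.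

(* This stands for [T (g * dp)], where the coefficientwise differential [dp]
   would be a polynomial with coefficients in [V]. *)
Definition tdif (g p : {poly F}) : V := \sum_(i < size p) T (g * 'X^i) *: dif p`_i.

Lemma tdif_widen n g (p : {poly F}) : (size p <= n)%N ->
  tdif g p = \sum_(i < n) T (g * 'X^i) *: dif p`_i.
Proof.
move=> pn; rewrite /tdif.
rewrite (@big_ord_widen V 0 +%R _ _ (fun i => T (g * 'X^i) *: dif p`_i) pn).
rewrite big_mkcond /=; apply: eq_bigr => i _; case: ltnP => // ip.
by rewrite nth_default // dif0 scaler0.
Qed.

Lemma functional0 : T 0 = 0.
Proof. by rewrite -(scale0r 0) TZ mul0r. Qed.

Lemma functional_sum I (r : seq I) P E :
  T (\sum_(i <- r | P i) E i) = \sum_(i <- r | P i) T (E i).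
Proof. by apply: (big_morph T TD functional0). Qed.

Lemma tdif_const g p : difconst p -> tdif g p = 0.
Proof. by move=> dp; rewrite /tdif big1 // => i _; rewrite dp scaler0. Qed.

Lemma tdifD g p q : tdif g (p + q) = tdif g p + tdif g q.
Proof.
set n := maxn (size p) (size q).
rewrite !(@tdif_widen n) ?leq_maxl ?leq_maxr ?size_polyD //.
by rewrite -big_split /=; apply: eq_bigr => i _; rewrite coefD difD scalerDr.
Qed.

Lemma tdifN g p : tdif g (- p) = - tdif g p.
Proof.
rewrite /tdif size_polyN -sumrN; apply: eq_bigr => i _.
by rewrite coefN difN scalerN.
Qed.

Lemma tdif_sum I (r : seq I) P E g :
  tdif g (\sum_(i <- r | P i) E i) = \sum_(i <- r | P i) tdif g (E i).
Proof.
apply: (big_morph (tdif g) (tdifD g)).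
by rewrite /tdif size_poly0 big_ord0.
Qed.

Lemma tdif_monomial g c n : tdif g (c *: 'X^n) = T (g * 'X^n) *: dif c.
Proof.
rewrite (@tdif_widen n.+1); last by rewrite (leq_trans (size_scale_leq _ _)) ?size_polyXn.
rewrite big_ord_recr /= big1 ?add0r => [|i _].
  by rewrite coefZ coefXn eqxx mulr1.
by rewrite coefZ coefXn (ltn_eqF (ltn_ord i)) mulr0 dif0 scaler0.
Qed.

Lemma tdif_suml I (r : seq I) P E p :
  tdif (\sum_(i <- r | P i) E i) p = \sum_(i <- r | P i) tdif (E i) p.
Proof.
rewrite /tdif exchange_big /=; apply: eq_bigr => i _.
by rewrite mulr_suml functional_sum scaler_suml.
Qed.

(** Both sides are additive in [p] and [q], so monomials suffice, and for them this is the product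
    rule [difM] of the coefficients. *)
Lemma tdifM g p q : tdif g (p * q) = tdif (g * p) q + tdif (g * q) p.
Proof.
have sumE (u : {poly F}) : u = \sum_(i < size u) u`_i *: 'X^i.
  by rewrite -[LHS]coefK poly_def.
have -> : g * p = \sum_(i < size p) g * (p`_i *: 'X^i).
  by rewrite {1}[p]sumE mulr_sumr.
have -> : g * q = \sum_(i < size q) g * (q`_i *: 'X^i).
  by rewrite {1}[q]sumE mulr_sumr.
rewrite !tdif_suml {1}[p]sumE {1}[q]sumE mulr_suml tdif_sum.
have -> : \sum_(i < size q) tdif (g * (q`_i *: 'X^i)) p =
    \sum_(i < size p) \sum_(k < size q) T (g * (q`_k *: 'X^k) * 'X^i) *: dif p`_i.
  by rewrite exchange_big.
rewrite -big_split /=; apply: eq_bigr => i _.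
rewrite mulr_sumr tdif_sum [X in _ = X + _]/tdif -big_split /=; apply: eq_bigr => k _.
have -> : p`_i *: 'X^i * (q`_k *: 'X^k) = (p`_i * q`_k) *: 'X^(i + k).
  by rewrite -scalerAl -scalerAr scalerA exprD.
rewrite tdif_monomial difM scalerDr !scalerA.
rewrite -!scalerAr -!scalerAl !TZ -!mulrA -!exprD [(k + i)%N]addnC.
by rewrite ![T _ * _]mulrC.
Qed.

End AbelIdentity.

(** * The sum of residues modulo a split polynomial *)

Section TopCoefficient.
Variables (F : fieldType) (k : nat) (t : 'I_k -> F) (c : F).
Let rho := c *: \prod_(n < k) ('X - (t n)%:P).

(** For [c != 0] this is [c] times the sum of the residues of [p / rho], written without the
    derivative of [rho]. *)
Definition modtop (p : {poly F}) := (p %% rho)`_k.-1.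

Lemma modtopD p q : modtop (p + q) = modtop p + modtop q.
Proof. by rewrite /modtop modpD coefD. Qed.

Lemma modtopZ a p : modtop (a *: p) = a * modtop p.
Proof. by rewrite /modtop modpZl coefZ. Qed.

Lemma modtop_eq p q : rho %| (p - q) -> modtop p = modtop q.
Proof.
move=> d; rewrite -[p](subrK q) modtopD {1}/modtop.
by move: d; rewrite /dvdp => /eqP ->; rewrite coef0 add0r.
Qed.

Hypothesis c0 : c != 0.

Lemma size_modulus : size rho = k.+1.
Proof. by rewrite size_scale // size_prod_XsubC /index_enum -enumT size_enum_ord. Qed.

Lemma modtop_small (p : {poly F}) : (size p < k)%N -> modtop p = 0.
Proof.
move=> pk; rewrite /modtop modp_small ?size_modulus ?(ltn_trans pk) //.
by rewrite nth_default // -ltnS prednK // (leq_trans _ pk).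
Qed.

(** Modulo [rho] the factor [p] may be replaced by its value at [t n], because the difference
    supplies the missing linear factor; the cofactor is monic of degree [k - 1]. Coincidences among
    the [t i] do not matter. *)
Lemma modtop_cofactor p n :
  modtop (p * \prod_(i < k | i != n) ('X - (t i)%:P)) = p.[t n].
Proof.
have k0 : (0 < k)%N by apply: leq_ltn_trans (ltn_ord n).
set u := \prod_(i < k | _) _.
have rE : rho = c *: (('X - (t n)%:P) * u) by rewrite /rho (bigD1 n).
have u_monic : u \is monic by apply: monic_prod => i _; apply: monicXsubC.
have su : size u = k.
  apply: succn_inj; rewrite -size_modulus rE size_scale //.
  by rewrite size_Mmonic ?polyXsubC_eq0 ?size_XsubC // monic_neq0 ?monicXsubC.
rewrite (@modtop_eq _ (p.[t n] *: u)); last first.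
  have /factor_theorem[w pE] : root (p - (p.[t n])%:P) (t n).
    by rewrite rootE !hornerE subrr.
  rewrite -mul_polyC -mulrBl pE rE dvdpZl //.
  by rewrite -mulrA dvdp_mull.
rewrite modtopZ /modtop modp_small ?size_modulus ?su //.
by move: (monicP u_monic); rewrite lead_coefE su => ->; rewrite mulr1.
Qed.

End TopCoefficient.

(* If [N] inverts [A P] times [Q] modulo [rho], then modulo [rho] the
   coefficientwise differential of [rho] multiplied by [N] is
   [2 (Q dP - P dQ)]; times [U] this has degree less than [k - 1], while its
   top coefficient is read off the linear factors of [rho] as the sum of the
   residues.  Multiple roots need no separate treatment. *)
Lemma abel_identity (F : fieldType) (V : lmodType F) (dif : F -> V)
    (difD : forall a b, dif (a + b) = dif a + dif b)
    (difM : forall a b, dif (a * b) = a *: dif b + b *: dif a)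
    (A B P Q U : {poly F}) (k : nat) (t : 'I_k -> F) (c : F) :
  c != 0 ->
  A * P ^+ 2 - B * Q ^+ 2 = c *: \prod_(n < k) ('X - (t n)%:P) ->
  difconst dif A -> difconst dif B ->
  (size U + size P + size Q <= k.+1)%N ->
  (forall n, (A * P).[t n] != 0) -> (forall n, Q.[t n] != 0) ->
  \sum_n (U.[t n] * (Q.[t n] / (A * P).[t n])) *: dif (t n) = 0.
Proof.
move=> c0 rhoE dA dB sz AP0 Q0; set rho := _ *: _ in rhoE.
have cop p : (forall n, p.[t n] != 0) -> coprimep p rho.
  move=> p0; rewrite /rho coprimepZr //.
  elim/big_rec: _ => [|n q _ cq]; first by rewrite coprimep1.
  by rewrite coprimepMr cq coprimep_XsubC rootE p0.
have [[u v] /= uvE] := Bezout_eq1_coprimepP _ _ (cop _ AP0).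
pose N := u * Q.
have NAP : rho %| N * A * P - Q.
  rewrite (_ : _ - _ = - (v * Q) * rho) ?dvdp_mull //.
  have -> : N * A * P = (u * (A * P)) * Q by rewrite /N; ring.
  by rewrite -[X in _ - X]mul1r -uvE; ring.
(* Mirror image of [NAP]: modulo [rho] one has [A P^2 = B Q^2], and [Q] can be cancelled. Together
   the two congruences turn [N A P dP] and [N B Q dQ] into [Q dP] and [P dQ]. *)
have NBQ : rho %| N * B * Q - P.
  rewrite -(Gauss_dvdpr _ (_ : coprimep rho Q)); last by rewrite coprimep_sym cop.
  have -> : Q * (N * B * Q - P) = P * (N * A * P - Q) - N * rho.
    by rewrite -rhoE; ring.
  by rewrite dvdp_sub ?dvdp_mull.
have NE n : N.[t n] = Q.[t n] / (A * P).[t n].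
  have : root (N * A * P - Q) (t n).
    rewrite root_factor_theorem; apply: dvdp_trans NAP.
    by rewrite /rho (bigD1 n) //= scalerAl dvdp_mulr // dvdpZr.
  by rewrite rootE hornerD hornerN -mulrA hornerM subr_eq0 => /eqP <-; rewrite mulfK.
pose T := modtop t c; pose L := tdif dif T.
have LD g p q : L g (p + q) = L g p + L g q by apply: tdifD.
have LN g p : L g (- p) = - L g p by apply: tdifN.
have LM g p q : L g (p * q) = L (g * p) q + L (g * q) p.
  by apply: tdifM => // *; [apply: modtopD | apply: modtopZ].
have Lc g p : difconst dif p -> L g p = 0 by apply: tdif_const.
have Leq g g' p : rho %| g - g' -> L g p = L g' p.
  move=> d; apply: eq_bigr => i _; congr (_ *: _); apply: modtop_eq.
  by rewrite -mulrBl dvdp_mulr.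
have L0 (g p : {poly F}) : (g != 0 -> (size g + size p <= k)%N) -> L g p = 0.
  have [-> _|g0 /(_ isT) s] := eqVneq g 0; apply: big1 => i _.
    by rewrite mul0r /T -(scale0r 0) modtopZ mul0r scale0r.
  rewrite /T modtop_small ?scale0r //.
  rewrite size_Mmonic ?monicXn // size_polyXn addnS /=.
  by apply: leq_trans s; rewrite ltn_add2l.
have L2 g p : L g (p ^+ 2) = 2%:R *: L (g * p) p.
  by rewrite expr2 LM scaler_nat mulr2n.
have dX : difconst dif 'X.
  by move=> i; rewrite coefX; case: (i == _); rewrite ?(dif0 difD) // (dif1 difM).
have LX p z : L p ('X - z%:P) = - (T p *: dif z).
  rewrite LD LN Lc // add0r; congr (- _).
  have -> : z%:P = z *: 'X^0 by rewrite expr0 alg_polyC.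
  by rewrite /L (tdif_monomial difD) expr0 mulr1.
(* Product rule for the linear factors. The induction runs over lists without repetition, so that
   excluding the index [n] removes exactly one factor. *)
have Lprod p (r : seq 'I_k) : uniq r -> L p (\prod_(n <- r) ('X - (t n)%:P)) =
    - \sum_(n <- r) T (p * \prod_(i <- r | i != n) ('X - (t i)%:P)) *: dif (t n).
  elim: r p => [|m r IH] p /=.
    by rewrite !big_nil oppr0 Lc //; apply: difconst1.
  move=> /andP[mr ur]; rewrite !big_cons eqxx /= LM LX IH // -opprD addrC.
  congr (- (_ + _)).
    congr (T (_ * _) *: _); rewrite big_seq [RHS]big_seq_cond.
    apply: eq_bigl => i; case: (boolP (i \in r)) => //= ir.
    by apply/esym; apply: contraNneq mr => <-.
  apply: eq_big_seq => n nr; rewrite big_cons (_ : m != n) ?mulrA //.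
  by apply: contraNneq mr => ->.
have Lrho : L (U * N) rho = 0.
  rewrite -rhoE LD LN (LM _ A) (LM _ B) ![L _ A]Lc // ![L _ B]Lc // !addr0 !L2 -scalerBr.
  rewrite (Leq (U * N * A * P) (U * Q)); last first.
    by rewrite -!(mulrA U) -mulrBr dvdp_mull.
  rewrite (Leq (U * N * B * Q) (U * P)); last first.
    by rewrite -!(mulrA U) -mulrBr dvdp_mull.
  have szM (p q r : {poly F}) : (size p + size q + size r <= k.+1)%N ->
      p * q != 0 -> (size (p * q)%R + size r <= k)%N.
    rewrite mulf_eq0 negb_or => s /andP[p0 q0]; rewrite size_mul //.
    move: p0 q0 s; rewrite -!size_poly_gt0.
    by case: (size p) (size q) => [|a] // [|b] // _ _; rewrite !addSn addnS !ltnS.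
  by rewrite !L0 ?subrr ?scaler0 //; apply: szM; rewrite // addnAC.
have : c *: (\sum_n (U.[t n] * (Q.[t n] / (A * P).[t n])) *: dif (t n)) = 0.
  transitivity (- L (U * N) rho); last by rewrite Lrho oppr0.
  (* The differential of the leading coefficient [c] enters with the value of [T] at a multiple of
     [rho], which is zero. *)
  rewrite /rho -mul_polyC LM [X in _ + X](_ : _ = 0) ?addr0; last first.
    rewrite -alg_polyC -[1](expr0 'X) /L (tdif_monomial difD) expr0 mulr1.
    rewrite (_ : T _ = 0) ?scale0r // -(mul0r (T 0)) -modtopZ scale0r.
    by apply: modtop_eq; rewrite subr0 dvdpZl // dvdp_mull.
  have -> : \prod_(n < k) ('X - (t n)%:P) = \prod_(n <- index_enum 'I_k) ('X - (t n)%:P).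
    by [].
  rewrite Lprod ?index_enum_uniq // opprK scaler_sumr; apply: eq_bigr => n _.
  rewrite /T modtop_cofactor // [(_ * _%:P).[_]]hornerM hornerC.
  by rewrite [(U * N).[_]]hornerM NE scalerA mulrC.
by move/eqP; rewrite scaler_eq0 (negPf c0) => /eqP.
Qed.

(** * Points and brackets *)

Lemma pull_head (V : zmodType) (a r t r' : V) : r = t + r' -> a + r = t + (a + r').
Proof. by move=> ->; rewrite addrCA. Qed.

Lemma cancel_neg (V : zmodType) (t s r : V) : s = - t + r -> r = 0 -> t + s = 0.
Proof. by move=> -> ->; rewrite addr0 subrr. Qed.

Lemma cancel_pos (V : zmodType) (t s r : V) : s = t + r -> r = 0 -> - t + s = 0.
Proof. by move=> -> ->; rewrite addr0 addNr. Qed.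

(* The ring operations of two equal monomials may come from different
   canonical instances, so monomials are compared up to these. *)
Ltac same_monomial a b :=
  match a with
  | ?a1 * ?a2 => match b with ?b1 * ?b2 => same_monomial a1 b1; same_monomial a2 b2 end
  | ?k *: ?a1 => match b with ?l *: ?b1 => same_monomial k l; same_monomial a1 b1 end
  | 1 => match b with 1 => idtac end
  | _ => constr_eq a b
  end.

Ltac pull t s :=
  match s with
  | ?u => let _ := match goal with _ => same_monomial u t end in constr:(esym (addr0 s))
  | ?u + ?r => let _ := match goal with _ => same_monomial u t end in constr:(erefl s)
  | ?a + ?r => let p := pull t r in constr:(pull_head a p)
  end.

Ltac pull_opp t s :=
  match s with
  | - ?u => let _ := match goal with _ => same_monomial u t end in constr:(esym (addr0 s))
  | - ?u + ?r => let _ := match goal with _ => same_monomial u t end in constr:(erefl s)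
  | ?a + ?r => let p := pull_opp t r in constr:(pull_head a p)
  end.

Ltac cancel_terms :=
  apply/eqP; rewrite -subr_eq0; apply/eqP;
  rewrite ?(opprD, opprK) -?addrA ?oppr0 ?addr0 ?add0r;
  repeat match goal with
  | |- 0 = 0 => reflexivity
  | |- - ?t + ?s = 0 => let p := pull t s in apply: (cancel_pos p)
  | |- ?t + ?s = 0 => let p := pull_opp t s in apply: (cancel_neg p)
  end.

Ltac expand := rewrite ?(mulrDl, mulrDr, mulrN, mulNr, scalerDr, scalerN, opprD,
  opprK, mulrA) -?(scalerAl, scalerAr) ?(mulrDl, mulrDr, mulrN, mulNr, scalerDr,
  scalerN, opprD, opprK, mulrA).

Section Points.
Variables (R : realType) (h : R[i]) (A : algType R[i]) (I : Type).
Variables (x y : I -> A).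

(* The defining relations of [H_I] in a form without the order of [I]. *)
Definition hpoints := forall i j,
  [/\ y i * y j = y j * y i, x i * y j = y j * x i + h *: (y i * y j)
    & x i * (x j - h *: y j) = x j * (x i - h *: y i)].

Hypothesis hp : hpoints.

Lemma hp_yy i j : y i * y j = y j * y i. Proof. by case: (hp i j). Qed.
Lemma hp_xy i j : x i * y j = y j * x i + h *: (y i * y j).
Proof. by case: (hp i j). Qed.
Lemma hp_xhx i j : x i * (x j - h *: y j) = x j * (x i - h *: y i).
Proof. by case: (hp i j). Qed.

Lemma hp_xx i j : x i * x j = x j * x i + h *: (y j * x i) - h *: (y i * x j).
Proof.
move/eqP: (hp_xhx i j); rewrite !mulrBr subr_eq => /eqP ->.
rewrite -!scalerAr (hp_xy j i) (hp_xy i j) (hp_yy j i).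
by expand; cancel_terms.

Qed.

Notation br i j := (bracket h (x i) (y i) (x j) (y j)).

(** Moving [y j] to the left absorbs the term with [h]; the bracket becomes a classical determinant
    and is visibly antisymmetric. *)
Lemma brE i j : br i j = y j * x i - y i * x j.
Proof. by rewrite /bracket hp_xy; cancel_terms. Qed.

Lemma br_diag i : br i i = 0.
Proof. by rewrite brE subrr. Qed.

Lemma br_commy i j k : y k * br i j = br i j * y k.
Proof.
rewrite !brE; expand; rewrite -!(mulrA (y _) (x _)) !hp_xy; expand.
by rewrite (hp_yy k j) (hp_yy k i) (hp_yy j i) ; cancel_terms.
Qed.

Lemma pluecker_y a b c : br a b * y c = br c b * y a + br a c * y b.
Proof.
rewrite -!br_commy !brE; expand.
by rewrite (hp_yy c b) (hp_yy c a) (hp_yy a b); cancel_terms.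
Qed.

Lemma br_commx i j k : x k * br i j = br i j * x k.
Proof.
rewrite !brE; expand; rewrite (hp_xy k j) (hp_xy k i); expand.
rewrite -!(mulrA (y _) (x _) (x _)) (hp_xx k i) (hp_xx k j); expand.
by rewrite (hp_yy j k) (hp_yy i k) (hp_yy i j); cancel_terms.
Qed.

Lemma pluecker_x a b c : br a b * x c = br c b * x a + br a c * x b.
Proof.
rewrite -!br_commx.
rewrite !brE; expand; rewrite !hp_xy; expand.
rewrite -!(mulrA (y _) (x _) (x _)) (hp_xx c a) (hp_xx c b) (hp_xx b a); expand.
by rewrite (hp_yy c b) (hp_yy c a) (hp_yy b a); cancel_terms.
Qed.

(** Cramer's rule. It holds for arbitrary [X] and [Y], without commutation relations, because they
    occur only as rightmost factors. It later recovers gamma and delta from two brackets. *)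
Lemma bracket_solve_y i j X Y :
  br i j * Y = y j * bracket h (x i) (y i) X Y - y i * bracket h (x j) (y j) X Y.
Proof. by rewrite brE /bracket; expand; rewrite (hp_yy j i); cancel_terms. Qed.

Lemma bracket_solve_x i j X Y :
  br i j * X = x j * bracket h (x i) (y i) X Y - x i * bracket h (x j) (y j) X Y.
Proof.
rewrite brE /bracket; expand; rewrite (hp_xx j i) (hp_xy j i) (hp_xy i j); expand.
by rewrite (hp_yy j i); cancel_terms.
Qed.

End Points.

Section Combinations.
Variables (R : realType) (h : R[i]) (A : algType R[i]) (I J : Type).
Variables (x y : I -> A) (hp : hpoints h x y) (p q : I) (u v : J -> A).
Hypothesis uC : forall j a, u j * a = a * u j.
Hypothesis vC : forall j a, v j * a = a * v j.

Let x' j := u j * x p + v j * x q.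
Let y' j := u j * y p + v j * y q.

Lemma combM i j (a b c d : A) : (u i * a + v i * b) * (u j * c + v j * d) =
  u i * u j * (a * c) + u i * v j * (a * d) + v i * u j * (b * c) + v i * v j * (b * d).
Proof.
have sw (s t a1 b1 : A) (tC : forall z, t * z = z * t) :
    s * a1 * (t * b1) = s * t * (a1 * b1).
  by rewrite -!mulrA; congr (s * _); rewrite !mulrA tC.
by rewrite mulrDl !mulrDr !(sw _ _ _ _ (uC j)) !(sw _ _ _ _ (vC j)) !addrA.
Qed.

(** The relations are bilinear in the two points and hold for all pairs, the diagonal ones included,
    so they pass to central linear combinations. This is what allows [p_0] to be moved freely. *)
Lemma comb_hpoints : hpoints h x' y'.
Proof.
have yy i j := hp_yy hp i j; have xy i j := hp_xy hp i j.
move=> i j; split.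
- rewrite !combM (uC j (u i)) (uC j (v i)) (vC j (u i)) (vC j (v i)) (yy q p).
  by cancel_terms.
- rewrite !combM (uC j (u i)) (uC j (v i)) (vC j (u i)) (vC j (v i)) !xy (yy q p).
  by expand; cancel_terms.
rewrite !mulrBr -!scalerAr !combM (uC j (u i)) (uC j (v i)) (vC j (u i)) (vC j (v i)).
rewrite (hp_xx hp q p) !xy (yy q p).
by expand; cancel_terms.
Qed.

Lemma comb_bracket i j : bracket h (x' i) (y' i) (x' j) (y' j) =
  (u i * v j - v i * u j) * bracket h (x p) (y p) (x q) (y q).
Proof.
rewrite (brE comb_hpoints) (brE hp) !combM.
rewrite (uC j (u i)) (uC j (v i)) (vC j (u i)) (vC j (v i)).
by rewrite mulrBl !mulrBr; cancel_terms.
Qed.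

End Combinations.

Lemma HI_relationsP (R : realType) (h : R[i]) disp (I : orderType disp)
    (A : algType R[i]) (x y : I -> A) :
  HI_relations h x y <-> hpoints h x y.
Proof.
split=> [[xyii rel]|hp]; last first.
  split=> [i|i j _]; first by rewrite (hp_xy hp).
  split; first by rewrite (hp_xy hp) (hp_yy hp j i).
  - by rewrite (hp_xy hp); cancel_terms.
  - exact: hp_yy hp _ _.
  rewrite (hp_xx hp i j) expr2 -scalerA (hp_xy hp i j).
  by expand; cancel_terms.
have yy i j : y i * y j = y j * y i.
  by case: (ltgtP i j) => [/rel[]|/rel[]|->].
have xy i j : x i * y j = y j * x i + h *: (y i * y j).
  case: (ltgtP i j) => [/rel[_ -> _ _]|/rel[-> _ _ _]|->] //; last by rewrite yy.
  by cancel_terms.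
have xx i j : (i < j)%O -> x i * (x j - h *: y j) = x j * (x i - h *: y i).
  case/rel=> _ _ _ xx; rewrite !mulrBr xx -!scalerAr (xy j i) expr2 -scalerA (yy j i).
  by expand; cancel_terms.
move=> i j; split=> //.
by case: (ltgtP i j) => [/xx|/xx|->].
Qed.

(** * Nondegeneracy of [H_I] *)

Section EndAlgebra.
Variable K : comNzRingType.
Let V : lmodType K := (int -> K^o)%type.

(** The operators act on sequences indexed by all integers, so that multiplication by [t] and by
    [1 / t] are both available and mutually inverse. *)
Record endo := Endo { endo_fun :> V -> V; endo_linear : linear endo_fun }.

Lemma endo_eq (f g : endo) : (forall v, f v = g v) -> f = g.
Proof.
case: f g => f lf [g lg] /= fg; have E : f = g by apply/funext.
by case: g / E lg fg => lg _; congr Endo; apply: Prop_irrelevance.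
Qed.

HB.instance Definition _ := gen_eqMixin endo.
HB.instance Definition _ := gen_choiceMixin endo.

Fact endo_add_subproof (f g : endo) : linear (fun v => f v + g v).
Proof.
by move=> a u v; rewrite !endo_linear scalerDr addrACA.
Qed.
Fact endo_opp_subproof (f : endo) : linear (fun v => - f v).
Proof. by move=> a u v; rewrite endo_linear opprD scalerN. Qed.
Fact endo_zero_subproof : linear (fun _ : V => 0 : V).
Proof. by move=> a u v; rewrite scaler0 addr0. Qed.
Fact endo_one_subproof : linear (fun v : V => v).
Proof. by []. Qed.
Fact endo_mul_subproof (f g : endo) : linear (fun v => f (g v)).
Proof. by move=> a u v; rewrite !endo_linear. Qed.
Fact endo_scale_subproof c (f : endo) : linear (fun v => c *: f v).
Proof. by move=> a u v; rewrite endo_linear scalerDr !scalerA mulrC. Qed.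

Lemma endoD (f : endo) u v : f (u + v) = f u + f v.
Proof. by rewrite -[u in LHS]scale1r endo_linear scale1r. Qed.
Lemma endo0 (f : endo) : f 0 = 0.
Proof. by apply: (@addrI _ (f 0)); rewrite -endoD !addr0. Qed.
Lemma endoZ (f : endo) c u : f (c *: u) = c *: f u.
Proof. by rewrite -[_ *: u]addr0 endo_linear endo0 addr0. Qed.

Let add f g := Endo (endo_add_subproof f g).
Let opp f := Endo (endo_opp_subproof f).
Let zero := Endo endo_zero_subproof.
Let one := Endo endo_one_subproof.
Let mul f g := Endo (endo_mul_subproof f g).
Let scale c f := Endo (endo_scale_subproof c f).

Fact endo_addA : associative add.
Proof. by move=> f g k; apply: endo_eq => v /=; rewrite addrA. Qed.
Fact endo_addC : commutative add.
Proof. by move=> f g; apply: endo_eq => v /=; rewrite addrC. Qed.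
Fact endo_add0 : left_id zero add.
Proof. by move=> f; apply: endo_eq => v /=; rewrite add0r. Qed.
Fact endo_addN : left_inverse zero opp add.
Proof. by move=> f; apply: endo_eq => v /=; rewrite addNr. Qed.
HB.instance Definition _ :=
  GRing.isZmodule.Build endo endo_addA endo_addC endo_add0 endo_addN.

Fact endo_mulA : associative mul.
Proof. by move=> f g k; apply: endo_eq. Qed.
Fact endo_mul1l : left_id one mul.
Proof. by move=> f; apply: endo_eq. Qed.
Fact endo_mul1r : right_id one mul.
Proof. by move=> f; apply: endo_eq. Qed.
Fact endo_mulDl : left_distributive mul add.
Proof. by move=> f g k; apply: endo_eq. Qed.
Fact endo_mulDr : right_distributive mul add.
Proof. by move=> f g k; apply: endo_eq => v /=; rewrite endoD. Qed.
Fact endo_1neq0 : one != 0.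
Proof.
apply/eqP => /(congr1 (fun f : endo => (f (fun=> 1) : int -> K) 0)) /= /eqP.
by rewrite oner_eq0.
Qed.
HB.instance Definition _ := GRing.Zmodule_isNzRing.Build endo
  endo_mulA endo_mul1l endo_mul1r endo_mulDl endo_mulDr endo_1neq0.

Fact endo_scaleA a b f : scale a (scale b f) = scale (a * b) f.
Proof. by apply: endo_eq => v /=; rewrite scalerA. Qed.
Fact endo_scale1 : left_id 1 scale.
Proof. by move=> f; apply: endo_eq => v /=; rewrite scale1r. Qed.
Fact endo_scaleDr : right_distributive scale +%R.
Proof. by move=> a f g; apply: endo_eq => v /=; rewrite scalerDr. Qed.
Fact endo_scaleDl f : {morph scale^~ f : a b / a + b}.
Proof. by move=> a b; apply: endo_eq => v /=; rewrite scalerDl. Qed.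
HB.instance Definition _ := GRing.Zmodule_isLmodule.Build K endo
  endo_scaleA endo_scale1 endo_scaleDr endo_scaleDl.

Fact endo_scaleAl (a : K) (f g : endo) : a *: (f * g) = (a *: f) * g.
Proof. by apply: endo_eq. Qed.
HB.instance Definition _ :=
  GRing.LSemiModule_isLSemiAlgebra.Build K endo endo_scaleAl.
Fact endo_scaleAr (a : K) (f g : endo) : a *: (f * g) = f * (a *: g).
Proof. by apply: endo_eq => v /=; rewrite endoZ. Qed.
HB.instance Definition _ := GRing.Lalgebra_isAlgebra.Build K endo endo_scaleAr.

Fact wshift_linear (c : int -> K) (m : int) :
  linear (fun f : V => (fun n => c n * f (n + m)) : V).
Proof.
move=> a f g; apply/funext => n; apply: (etrans (mulrDr _ _ _)).
by congr (_ + _); apply: mulrCA.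
Qed.

(* On formal series, [f = \sum_n f n t^n], this maps [t^n] to
   [c (n - m) t^(n - m)]. *)
Definition wshift c m : endo := Endo (wshift_linear c m).

Lemma wshiftM c d m k :
  wshift c m * wshift d k = wshift (fun n => c n * d (n + m)) (m + k).
Proof. by apply: endo_eq => f /=; apply/funext => n; rewrite mulrA addrA. Qed.

Lemma wshiftD c d m : wshift c m + wshift d m = wshift (fun n => c n + d n) m.
Proof. by apply: endo_eq => f; apply/funext => n; rewrite /= mulrDl. Qed.

Lemma wshiftZ a c m : a *: wshift c m = wshift (fun n => a * c n) m.
Proof. by apply: endo_eq => f; apply/funext => n; rewrite /= -mulrA. Qed.

Lemma wshift1 : wshift (fun=> 1) 0 = 1.
Proof. by apply: endo_eq => f; apply/funext => n /=; rewrite mul1r addr0. Qed.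

End EndAlgebra.

(* With [t = y], [x = h t^2 d/dt + h t] and [n = 1 / t], the pairs
   [(e_i x + a_i n, e_i y)] satisfy the relations of [H_I] and their brackets
   are the scalars [a_i e_j - e_i a_j]. *)
Lemma scalar_bracket_model (R : realType) (h : R[i]) (I : Type) (a e : I -> R[i]) :
  exists (B : algType R[i]) (x y : I -> B), hpoints h x y /\
    forall i j, bracket h (x i) (y i) (x j) (y j) = (a i * e j - e i * a j)%:A.
Proof.
pose B : algType R[i] := endo R[i].
pose X : B := wshift (fun n => h * n%:~R) (-1).
pose Y : B := wshift (fun=> 1) (-1).
pose N : B := wshift (fun=> 1) 1.
have XY : X * Y = Y * X + h *: (Y * Y).
  rewrite !wshiftM wshiftZ wshiftD; congr wshift; apply/funext => n.
  by rewrite !mul1r mulr1 -mulrDr intrD addrNK.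
have NY : N * Y = 1.
  by rewrite wshiftM -wshift1; congr wshift; apply/funext => n; rewrite mulr1.
have YN : Y * N = 1.
  by rewrite wshiftM -wshift1; congr wshift; apply/funext => n; rewrite mulr1.
have NX : N * X = X * N + h *: 1.
  rewrite !wshiftM -wshift1 wshiftZ wshiftD; congr wshift; apply/funext => n.
  by rewrite mul1r !mulr1 intrD mulrDr mulr1.
exists B, (fun i => e i *: X + a i *: N), (fun i => e i *: Y).
have hp : hpoints h (fun i => e i *: X + a i *: N) (fun i => e i *: Y).
  move=> i j; split.
  - by rewrite -!scalerAl -!scalerAr !scalerA mulrC.
  - rewrite mulrDl mulrDr -!scalerAl -!scalerAr XY NY YN !scalerDr !scalerA.
    by rewrite ![e j * _]mulrC -[h * _ * _]mulrA [h * _]mulrC addrAC.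
  rewrite !mulrBr !mulrDl !mulrDr -!scalerAl -!scalerAr XY NY NX !scalerA.
  rewrite !scalerDr !scalerA.
  have -> : a i * (h * e j) = a i * e j * h by ring.
  have -> : a j * (h * e i) = a j * e i * h by ring.
  have -> : e j * (h * e i) = e i * (h * e j) by ring.
  rewrite (mulrC (e j) (e i)) (mulrC (e j) (a i)) (mulrC (a j)) (mulrC (a j)).
  by cancel_terms.
split=> // i j; rewrite (brE hp) !mulrDr -!scalerAl -!scalerAr YN !scalerA.
rewrite scalerBl (mulrC (e j)) (mulrC (e j)); by cancel_terms.
Qed.

Lemma bracket_morph (R : realType) (h : R[i]) (A B : algType R[i])
    (phi : {lrmorphism A -> B}) (X Y X' Y' : A) :
  phi (bracket h X Y X' Y') = bracket h (phi X) (phi Y) (phi X') (phi Y').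
Proof.
rewrite /bracket 2!raddfB /= !rmorphM; congr (_ - _).
by rewrite linearZ /= rmorphM.
Qed.

Section Nondegenerate.
Variables (R : realType) (h : R[i]) (disp : Order.disp_t) (I : orderType disp).
Variables (H : algType R[i]) (x y : I -> H) (isH : is_HI h x y).

Lemma HI_hpoints : hpoints h x y.
Proof. by case: isH => /HI_relationsP. Qed.

Lemma HI_scalar_model (a e : I -> R[i]) :
  exists (B : algType R[i]) (phi : {lrmorphism H -> B}), forall i j,
    phi (bracket h (x i) (y i) (x j) (y j)) = (a i * e j - e i * a j)%:A.
Proof.
have [B [x' [y' [/HI_relationsP rel br']]]] := scalar_bracket_model h a e.
have [_ _ /(_ B x' y' rel)[phi phiE]] := isH.
exists B, phi => i j; rewrite bracket_morph.
by have [-> ->] := phiE i; have [-> ->] := phiE j; apply: br'.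
Qed.

Lemma bracket_neq0 i j : i != j -> bracket h (x i) (y i) (x j) (y j) != 0.
Proof.
move=> ij; have [B [phi phiE]] :=
  HI_scalar_model (fun k => (k == i)%:R) (fun k => (k == j)%:R).
apply/eqP => /(congr1 phi); rewrite phiE !eqxx (negPf ij) mulr1 mul0r subr0 scale1r.
by rewrite rmorph0 => /eqP; rewrite oner_eq0.
Qed.

End Nondegenerate.

(** * The form [r] *)

Section Subalgebras.
Variables (R : realType) (A : algType R[i]) (G : set A).

Lemma subalg1 : subalg G 1.
Proof. by rewrite -[1]scale1r; apply: subalg_scalar. Qed.

Lemma subalgZ c a : subalg G a -> subalg G (c *: a).
Proof.
move=> Ga; rewrite -[a]mul1r scalerAl.
by apply: subalg_mul => //; apply: subalg_scalar.
Qed.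

Lemma subalgB a b : subalg G a -> subalg G b -> subalg G (a - b).
Proof.
by move=> Ga Gb; rewrite -scaleN1r; apply: subalg_add => //; apply: subalgZ.
Qed.

Lemma subalg_prod I (r : seq I) (P : pred I) E :
  (forall i, P i -> subalg G (E i)) -> subalg G (\prod_(i <- r | P i) E i).
Proof.
move=> GE; elim/big_rec: _ => [|i a Pi Ga]; first exact: subalg1.
by apply: subalg_mul => //; apply: GE.
Qed.

Lemma subalg_lrmorph (B : algType R[i]) (f g : {lrmorphism A -> B}) :
  (forall a, G a -> f a = g a) -> forall a, subalg G a -> f a = g a.
Proof.
move=> fg a; elim=> {a} [a /fg //|c|a b _ fa _ fb|a b _ fa _ fb].
- by rewrite !linearZ !rmorph1.
- by rewrite !raddfD; congr (_ + _).
- by rewrite !rmorphM; congr (_ * _).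
Qed.

End Subalgebras.

Lemma abel_form_morph (R : realType) (h : R[i]) (disp : Order.disp_t)
    (I : orderType disp) (A B : algType R[i]) (phi : {lrmorphism A -> B})
    (x y : I -> A) (o : I) N s p q (i_ : 'I_N -> I) (k_ : 'I_p -> I)
    (l_ : 'I_q -> I) :
  let b i := phi (bracket h (x o) (y o) (x i) (y i)) in
  phi (abel_form h x y o s i_ k_ l_) =
    (\prod_(m < N | (m < s)%N) b (i_ m)) * (\prod_(m < p) b (k_ m)) ^+ 2 -
    (\prod_(m < N | (s <= m)%N) b (i_ m)) * (\prod_(m < q) b (l_ m)) ^+ 2.
Proof.
rewrite /abel_form raddfB /=.
by congr (_ - _); rewrite rmorphM rmorphXn !rmorph_prod.
Qed.

Lemma uniq_codomsP (I : eqType) (o : I) (N p q : nat) (i_ : 'I_N -> I)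
    (k_ : 'I_p -> I) (l_ : 'I_q -> I) :
  uniq (o :: codom i_ ++ codom k_ ++ codom l_) ->
  [/\ [/\ forall m, i_ m != o, forall m, k_ m != o & forall m, l_ m != o],
      injective i_, forall m n, i_ m != k_ n, forall m n, i_ m != l_ n
    & forall m n, k_ m != l_ n].
Proof.
rewrite /= !mem_cat !negb_or !cat_uniq => /andP[/and3P[oi ok ol]].
case/and3P=> ui ikl /and3P[_ kl _].
have ne T (f : T -> I) (s : seq I) c m : c \notin s -> f m \in s -> f m != c.
  by move=> cs fs; apply: contraNneq cs => <-.
split; first by split=> m; [apply: ne oi _|apply: ne ok _|apply: ne ol _]; apply: codom_f.
- exact/injectiveP.
- move=> m n; apply: contraNneq ikl => E; apply/hasP; exists (k_ n).
    by rewrite mem_cat codom_f.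
  by rewrite /= -E codom_f.
- move=> m n; apply: contraNneq ikl => E; apply/hasP; exists (l_ n).
    by rewrite mem_cat codom_f orbT.
  by rewrite /= -E codom_f.
move=> m n; apply: contraNneq kl => E; apply/hasP; exists (l_ n).
  by rewrite codom_f.
by rewrite /= -E codom_f.
Qed.

Section AbelForm.
Variables (R : realType) (h : R[i]) (disp : Order.disp_t) (I : orderType disp).
Variables (H : algType R[i]) (x y : I -> H) (isH : is_HI h x y).
Variables (UH : Uh_module_algebra h H) (actH : is_HI_action x y UH).
Let hp := HI_hpoints isH.
Notation br i j := (bracket h (x i) (y i) (x j) (y j)).

Definition brackets : set H := [set b | exists i j, b = br i j].

Lemma brackets_subalg i j : subalg brackets (br i j).
Proof. by apply: subalg_gen; exists i, j. Qed.

Lemma invariant_opK (v : H) : Defs.invariant UH v -> opK UH v = v /\ opK' UH v = v.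
Proof.
case=> _ Fv _; rewrite (@opK_exp _ _ _ UH 1) // (@opK'_exp _ _ _ UH 1) //.
by rewrite !big_ord1 !expr0 divr1 !scale1r.
Qed.

Lemma subalg_invariant (G : set H) : (forall a, G a -> Defs.invariant UH a) ->
  forall a, subalg G a -> Defs.invariant UH a.
Proof.
move=> GU a; elim=> {a} [a /GU //|c|a b _ [Ea Fa Ha] _ [Eb Fb Hb]|a b _ Ua _ Ub].
- by split; rewrite linearZ /= ?opE1 ?opF1 ?opH1 scaler0.
- by split; rewrite raddfD /= ?Ea ?Fa ?Ha ?Eb ?Fb ?Hb addr0.
have [Ka Ka'] := invariant_opK Ua; have [Kb Kb'] := invariant_opK Ub.
case: Ua Ub => [Ea Fa Ha] [Eb Fb Hb].
by split; rewrite ?opEM ?opFM ?opHM ?Ea ?Fa ?Ha ?Eb ?Fb ?Hb !(mul0r, mulr0) addr0.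
Qed.

Lemma bracket_invariant i j : Defs.invariant UH (br i j).
Proof.
have Hx k : opH UH (x k) = x k by case: (actH k) => -[].
have Hy k : opH UH (y k) = - y k by case: (actH k) => -[].
have Ex k : opE UH (x k) = 0 by case: (actH k) => -[].
have Ey k : opE UH (y k) = x k by case: (actH k) => -[].
have Fx k : opF UH (x k) = y k by case: (actH k) => _ [].
have Fy k : opF UH (y k) = 0 by case: (actH k) => _ [].
have Ky k : opK UH (y k) = y k.
  by rewrite (@opK_exp _ _ _ UH 1) /= ?Fy // big_ord1 expr0 divr1 scale1r.
have Ky' k : opK' UH (y k) = y k.
  by rewrite (@opK'_exp _ _ _ UH 1) /= ?Fy // big_ord1 expr0 divr1 scale1r.
have Kx k : opK UH (x k) = x k + h *: y k.
  rewrite (@opK_exp _ _ _ UH 2) /= ?Fx ?Fy // big_ord_recr big_ord1 /= Fx.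
  by rewrite expr0 expr1 !divr1 scale1r.
have Kx' k : opK' UH (x k) = x k - h *: y k.
  rewrite (@opK'_exp _ _ _ UH 2) /= ?Fx ?Fy // big_ord_recr big_ord1 /= Fx.
  by rewrite expr0 expr1 !divr1 scale1r scaleNr.
rewrite (brE hp); split; rewrite raddfB /=.
(* Invariance under E is exactly the relation between [x i] and [x j] in [hpoints], since [e^{-hF}]
   maps [x i] to [x i - h y i]. *)
- rewrite !opEM !Ex !Ey !mulr0 !Kx' !addr0.
  rewrite (hp_xhx hp); exact: subrr.
- by rewrite !opFM !Fx !Fy !mul0r !add0r (hp_yy hp j i) subrr.
rewrite !opHM !Hy !Hx !Ky !Kx'; expand.
rewrite (hp_yy hp j i); by cancel_terms.
Qed.

Lemma brackets_invariant a : subalg brackets a -> Defs.invariant UH a.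
Proof. by apply: subalg_invariant => b [i [j ->]]; apply: bracket_invariant. Qed.

Lemma brackets_central a b : subalg brackets a -> a * b = b * a.
Proof.
have cen a' : subalg brackets a' -> forall k, a' * x k = x k * a' /\ a' * y k = y k * a'.
  move=> Ga k; elim: Ga => {a'}
    [a' [i [j ->]]|c|a1 a2 _ [x1 y1] _ [x2 y2]|a1 a2 _ [x1 y1] _ [x2 y2]].
  - by rewrite br_commx // br_commy.
  - by rewrite -!scalerAl -!scalerAr !mul1r !mulr1.
  - by rewrite !mulrDl !mulrDr x1 x2 y1 y2.
  - by rewrite -!mulrA x2 y2 !mulrA x1 y1.
move=> /cen ca; have [_ /(_ b) gb _] := isH.
elim: gb => {b} [b [i _ []->]|c|b1 b2 _ c1 _ c2|b1 b2 _ c1 _ c2].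
- by case: (ca i).
- by case: (ca i).
- by rewrite -scalerAl -scalerAr mul1r mulr1.
- by rewrite mulrDl mulrDr c1 c2.
- by rewrite mulrA c1 -mulrA c2 mulrA.
Qed.

Variable o : I.
Notation HJo := (HJ x y (~` [set o])).

Definition homog n f := exists c : 'I_n.+1 -> H, (forall i, HJo (c i)) /\
  f = \sum_(i < n.+1) x o ^+ (n - i) * y o ^+ i * c i.

Lemma homogD n f f' : homog n f -> homog n f' -> homog n (f + f').
Proof.
move=> [c [cP ->]] [c' [cP' ->]]; exists (fun i => c i + c' i); split=> [i|].
  by apply: subalg_add; [apply: cP | apply: cP'].
by rewrite -big_split; apply: eq_bigr => i _; rewrite mulrDr.
Qed.

Lemma homog_term n i c : (i <= n)%N -> HJo c ->
  homog n (x o ^+ (n - i) * y o ^+ i * c).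
Proof.
move=> lin cP; exists (fun k => if k == i :> nat then c else 0); split=> [k|].
  by case: ifP => // _; rewrite -(scale0r 1); apply: subalg_scalar.
rewrite (bigD1 (Ordinal (lin : (i < n.+1)%N))) //= eqxx big1 ?addr0 // => k.
by rewrite -val_eqE => /= /negPf ->; rewrite mulr0.
Qed.

Lemma homogZ n f (c : R[i]) : homog n f -> homog n (c *: f).
Proof.
move=> [e [eP ->]]; exists (fun i => c *: e i); split=> [i|].
  by apply: subalgZ; apply: eP.
by rewrite scaler_sumr; apply: eq_bigr => i _; rewrite scalerAr.
Qed.

Lemma homogB n f f' : homog n f -> homog n f' -> homog n (f - f').
Proof. by move=> hf /(homogZ (-1)); rewrite scaleN1r; apply: homogD. Qed.

Lemma homog_sum n (J : Type) (r : seq J) (P : pred J) E :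
  (forall k, P k -> homog n (E k)) -> homog n (\sum_(k <- r | P k) E k).
Proof.
move=> hE; elim/big_rec: _ => [|k f Pk]; last by apply: homogD; apply: hE.
rewrite -(mulr0 (x o ^+ (n - 0) * y o ^+ 0)); apply: homog_term => //.
by rewrite -(scale0r 1); apply: subalg_scalar.
Qed.

(** The bracket is central, so it can be put directly in front of the power of [y o]. Then [x i] and
    [y i] are moved to the right of this power, which only changes [x i] by a multiple of [y i] and
    so leaves a coefficient without the index [o]. *)
Lemma homog_br n f i : i != o -> homog n f -> homog n.+1 (br o i * f).
Proof.
move=> io [c [cP ->]].
have iP : (~` [set o]) i by move/eqP: io.
have HJx : HJo (x i) by apply: subalg_gen; exists i => //; left.
have HJy : HJo (y i) by apply: subalg_gen; exists i => //; right.
have C u v w : br o i * (u * v * w) = u * (br o i * v) * w.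
  by rewrite !mulrA; congr (_ * _ * _); apply: brackets_central; apply: brackets_subalg.
rewrite mulr_sumr; apply: homog_sum => k _.
have xyk m : x i * y o ^+ m = y o ^+ m * (x i + (m%:R * h) *: y i).
  elim: m => [|m IH]; first by rewrite !expr0 mul0r scale0r addr0 mul1r mulr1.
  rewrite exprSr mulrA IH -!mulrA; congr (_ * _).
  rewrite mulrDl (hp_xy hp) -scalerAl mulrDr (hp_yy hp i o) -scalerAr -addrA -scalerDl.
  by rewrite -[m.+1]addn1 natrD mulrDl mul1r [h + _]addrC.
have -> : br o i * (x o ^+ (n - k) * y o ^+ k * c k) =
    x o ^+ (n.+1 - k) * y o ^+ k * (y i * c k) -
    x o ^+ (n.+1 - k.+1) * y o ^+ k.+1 * ((x i + (k.+1%:R * h) *: y i) * c k).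
  have yik : y i * y o ^+ k = y o ^+ k * y i.
    by apply: commrX; apply: hp_yy hp _ _.
  have brk : br o i * y o ^+ k =
      x o * y o ^+ k * y i - y o ^+ k.+1 * (x i + (k.+1%:R * h) *: y i).
    rewrite /bracket !mulrBl -!mulrA yik xyk -scalerAl -mulrA yik.
    rewrite -addrA -opprD exprS -mulrA.
    congr (_ - _); rewrite 2!scalerAr -2!mulrDr -addrA -scalerDl.
    by rewrite -[k.+1]addn1 natrD mulrDl mul1r.
  have -> : br o i * (x o ^+ (n - k) * y o ^+ k * c k) =
      x o ^+ (n - k) * (br o i * y o ^+ k) * c k.
    exact: C.
  have kn : (k <= n)%N by rewrite -ltnS.
  have -> : x o ^+ (n.+1 - k) = x o ^+ (n - k) * x o by rewrite subSn // exprSr.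
  rewrite brk subSS; move: (x o ^+ _) (y o ^+ k) (y o ^+ k.+1) => u v w.
  by rewrite mulrBr mulrBl !mulrA.
have kn : (k <= n)%N by rewrite -ltnS.
apply: homogB; apply: homog_term => //; first exact: leqW.
  by apply: subalg_mul; last apply: cP.
by apply: subalg_mul; [apply: subalg_add => //; apply: subalgZ | apply: cP].
Qed.

Lemma homog_prod (J : Type) (r : seq J) (P : pred J) (i_ : J -> I) n f :
  (forall k, P k -> i_ k != o) -> homog n f ->
  homog (\sum_(k <- r | P k) 1 + n) ((\prod_(k <- r | P k) br o (i_ k)) * f).
Proof.
move=> io hf; elim: r => [|k r IH]; first by rewrite !big_nil mul1r.
rewrite !big_cons; case: ifP => // Pk.
by rewrite -mulrA add1n addSn; apply: homog_br => //; apply: io.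
Qed.

Lemma homog1 : homog 0 1.
Proof.
have := @homog_term 0 0 1 isT (@subalg1 _ _ _).
by rewrite subn0 !expr0 !mul1r.
Qed.

Variables (N s p q : nat) (i_ : 'I_N -> I) (k_ : 'I_p -> I) (l_ : 'I_q -> I).
Hypothesis s_le : (s <= N)%N.

Lemma abel_form_brackets : subalg brackets (abel_form h x y o s i_ k_ l_).
Proof.
have b i : subalg brackets (br o i) by apply: brackets_subalg.
by apply: subalgB; rewrite expr2; do !apply: subalg_mul; apply: subalg_prod.
Qed.

Lemma card_lt_ord : (\sum_(m < N | (m < s)%N) 1 = s)%N.
Proof. by rewrite (big_ord_narrow s_le) sum1_card card_ord. Qed.

Lemma card_ge_ord : (\sum_(m < N | (s <= m)%N) 1 = N - s)%N.
Proof.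
have : (\sum_(m < N) 1 = N)%N by rewrite sum1_card card_ord.
rewrite (bigID (fun m : 'I_N => (m < s)%N)) /= card_lt_ord.
under eq_bigl do rewrite -leqNgt.
by move/(congr1 (subn^~ s)); rewrite addKn.
Qed.

Lemma abel_form_homog : (s + 2 * p = N - s + 2 * q)%N ->
  (forall m, i_ m != o) -> (forall m, k_ m != o) -> (forall m, l_ m != o) ->
  homog (s + 2 * p) (abel_form h x y o s i_ k_ l_).
Proof.
move=> sp io ko lo; have hs (J : finType) (c_ : J -> I) := 
  @homog_prod J (index_enum J) predT c_.
rewrite /abel_form !expr2; apply: homogB.
  have := hs _ k_ 0%N 1 (fun m _ => ko m) homog1.
  move/(hs _ k_ _ _ (fun m _ => ko m)).
  move/(@homog_prod _ (index_enum 'I_N) (fun m => (m < s)%N) _ _ _ (fun m _ => io m)).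
  by rewrite card_lt_ord !sum1_card card_ord addn0 addnn -mul2n mulr1.
rewrite sp.
have := hs _ l_ 0%N 1 (fun m _ => lo m) homog1.
move/(hs _ l_ _ _ (fun m _ => lo m)).
move/(@homog_prod _ (index_enum 'I_N) (fun m => (s <= m)%N) _ _ _ (fun m _ => io m)).
by rewrite card_ge_ord !sum1_card card_ord addn0 addnn -mul2n mulr1.
Qed.

Hypothesis N_gt0 : (0 < N)%N.
Hypothesis distinct : uniq (o :: codom i_ ++ codom k_ ++ codom l_).

Lemma abel_form_neq0 : abel_form h x y o s i_ k_ l_ != 0.
Proof.
pose m0 := Ordinal N_gt0.
(* A model in which the bracket of [o] with [i_ m0] is 2 and its brackets with all other points are
   1. As [i_ m0] occurs in exactly one of the two summands, and there only once, r becomes [2 - 1]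
   or [1 - 2]. *)
pose w c := if c == i_ m0 then 2%N else 1%N.
have [B [phi phiE]] := HI_scalar_model isH (fun c => (c == o)%:R)
  (fun c => if c == o then 0 else (w c)%:R).
have phib c : c != o -> phi (br o c) = (w c)%:R.
  by move=> /negPf co; rewrite phiE eqxx co mul1r mul0r subr0 scaler_nat.
apply/eqP => /(congr1 phi); rewrite abel_form_morph rmorph0.
have [[io ko lo] inj ik il _] := uniq_codomsP distinct.
have phik : \prod_(m < p) phi (br o (k_ m)) = 1.
  by rewrite big1 // => m _; rewrite phib // /w eq_sym (negPf (ik _ _)).
have phil : \prod_(m < q) phi (br o (l_ m)) = 1.
  by rewrite big1 // => m _; rewrite phib // /w eq_sym (negPf (il _ _)).
have phii (P : pred 'I_N) :
    \prod_(m < N | P m) phi (br o (i_ m)) = if P m0 then 2%:R else 1.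
  have w1 m : m != m0 -> w (i_ m) = 1%N by move=> mm0; rewrite /w (inj_eq inj) (negPf mm0).
  rewrite (eq_bigr (fun m => (w (i_ m))%:R)) => [|m _]; last by rewrite phib.
  rewrite -natr_prod; case: ifP => Pm0; last first.
    by rewrite big1 // => m Pm; apply: w1; apply: contraTneq Pm => ->; rewrite Pm0.
  rewrite (bigD1 m0) //= {1}/w eqxx big1 ?muln1 // => m /andP[_ mm0].
  exact: w1.
rewrite phik phil !phii expr1n !mulr1.
have d21 : 2%:R - 1 = 1 :> B by rewrite (natrD _ 1 1) addrK.
case: (ltnP m0 s) => _; first by rewrite d21 => /eqP; rewrite oner_eq0.
by move/eqP; rewrite -oppr_eq0 opprB d21 oner_eq0.
Qed.

End AbelForm.

(** * The field of central elements with central differential *)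

Section DifferentialField.
Variables (R : realType) (S : unitAlgType R[i]) (M : lmodType S).
Variables (rm : M -> S -> M) (d : S -> M).

Record skew_calculus : Prop := SkewCalculus {
  sc_skew : is_skew_field S;
  sc_bimodule : is_bimodule rm;
  sc_add : forall s t, d (s + t) = d s + d t;
  sc_leibniz : forall s t, d (s * t) = rm (d s) t + s *: d t
}.

Variable sc : skew_calculus.
Let bi := sc_bimodule sc.

Lemma calculus_d0 : d 0 = 0.
Proof. by apply: (@addrI _ (d 0)); rewrite -(sc_add sc) !addr0. Qed.

Lemma calculus_d1 : d 1 = 0.
Proof.
apply: (@addrI _ (d 1)); rewrite addr0 -[in RHS](mulr1 1) (sc_leibniz sc).
by rewrite scale1r (rm1 bi).
Qed.

Lemma calculus_dN s : d (- s) = - d s.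
Proof. by apply/eqP; rewrite -addr_eq0 -(sc_add sc) addNr calculus_d0. Qed.

Lemma calculus_rm0 s : rm 0 s = 0.
Proof. by apply: (@addrI _ (rm 0 s)); rewrite -(rmDl bi) !addr0. Qed.

Lemma calculus_rmN m s : rm (- m) s = - rm m s.
Proof. by apply/eqP; rewrite -addr_eq0 -(rmDl bi) addNr calculus_rm0. Qed.

(* The dummy argument lets the structures on [dfield] below, which need the
   proofs in [sc], be inferred from the type. *)
Definition dcentral of skew_calculus : {pred S} := fun z =>
  `[< (forall s, z * s = s * z) /\ (forall s, s *: d z = rm (d z) s) >].

Lemma dcentralP z : reflect
  ((forall s, z * s = s * z) /\ (forall s, s *: d z = rm (d z) s)) (z \in dcentral sc).
Proof. by rewrite unfold_in; apply: asboolP. Qed.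

Fact dcentral_divring : divring_closed (dcentral sc).
Proof.
have inv0 z : z \in dcentral sc -> z^-1 \in dcentral sc.
  move=> /dcentralP[zC dzC]; have [->|z0] := eqVneq z 0.
    rewrite invr0; apply/dcentralP.
    by split=> s; rewrite ?mul0r ?mulr0 ?calculus_d0 ?scaler0 ?calculus_rm0.
  have zU := sc_skew sc z0.
  have ziC s : z^-1 * s = s * z^-1 by rewrite -{1}(mulrK zU s) -zC mulrA mulKr.
  have dzi : d z^-1 = - (z^-1 * z^-1) *: d z.
    have : d (z * z^-1) = 0 by rewrite mulrV // calculus_d1.
    rewrite (sc_leibniz sc) -dzC => /eqP; rewrite addrC addr_eq0 => /eqP E.
    by rewrite -[LHS]scale1r -(mulVr zU) -scalerA E scalerN scalerA scaleNr.
  apply/dcentralP; split=> // s.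
  rewrite dzi (rmZ bi) -dzC !scalerA mulrN mulNr; congr (- _ *: _).
  by rewrite mulrA -ziC -mulrA -ziC mulrA.
split.
- apply/dcentralP; split=> s; first by rewrite mul1r mulr1.
  by rewrite calculus_d1 calculus_rm0 scaler0.
- move=> a b /dcentralP[aC daC] /dcentralP[bC dbC]; apply/dcentralP; split=> s.
    by rewrite mulrBl mulrBr aC bC.
  by rewrite (sc_add sc) calculus_dN scalerBr daC dbC (rmDl bi) calculus_rmN.
move=> a b /dcentralP[aC daC] /inv0/dcentralP[bC dbC]; apply/dcentralP.
split=> s; first by rewrite -mulrA bC mulrA aC mulrA.
rewrite (sc_leibniz sc) -daC scalerDr !scalerA -aC -bC (rmDl bi) !(rmZ bi) -daC -dbC.
by rewrite !scalerA.
Qed.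

HB.instance Definition _ :=
  GRing.isDivringClosed.Build S (dcentral sc) dcentral_divring.

Record dfield := DField { dfield_val : S; dfieldP : dfield_val \in dcentral sc }.

HB.instance Definition _ := [isSub for dfield_val].
HB.instance Definition _ := [Choice of dfield by <:].
HB.instance Definition _ :=
  [SubChoice_isSubUnitRing of dfield by <:].

Fact dfield_mulC : commutative (@GRing.mul (dfield)).
Proof.
by move=> a b; apply: val_inj; rewrite !rmorphM /=; case/dcentralP: (dfieldP a).
Qed.
HB.instance Definition _ :=
  GRing.PzRing_hasCommutativeMul.Build (dfield) (dfield_mulC).

Fact dfield_field : GRing.field_axiom (dfield).
Proof. 
move=> a a0; have va0 : val a != 0 by rewrite -(inj_eq val_inj) rmorph0 in a0.
have iP : (val a)^-1 \in dcentral sc by rewrite rpredV; apply: dfieldP.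
apply/unitrPr; exists (DField iP); apply: val_inj.
by rewrite rmorphM /= divrr ?rmorph1 // (sc_skew sc va0).
Qed.
HB.instance Definition _ :=
  GRing.ComUnitRing_isField.Build (dfield) (dfield_field).

(** [M] with its scalars restricted to [dfield], under a new name so that the two module structures
    are kept apart. *)
Definition dmod_of of skew_calculus := (M : Type).
Notation dmod := (dmod_of sc).
HB.instance Definition _ := GRing.Zmodule.copy (dmod) M.
Definition dmod_scale (a : dfield) (m : dmod) : dmod := val a *: (m : M).
Fact dmod_scaleA (a b : dfield) m :
  dmod_scale a (dmod_scale b m) = dmod_scale (a * b) m.
Proof. by rewrite /dmod_scale scalerA rmorphM. Qed.
Fact dmod_scale1 : left_id 1 (dmod_scale).
Proof. by move=> m; rewrite /dmod_scale rmorph1 scale1r. Qed.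
Fact dmod_scaleDr : right_distributive (dmod_scale) +%R.
Proof. by move=> a m n; apply: scalerDr. Qed.
Fact dmod_scaleDl m : {morph (dmod_scale)^~ m : a b / a + b}.
Proof. by move=> a b; rewrite /dmod_scale rmorphD scalerDl. Qed.
HB.instance Definition _ :=
  GRing.Zmodule_isLmodule.Build (dfield) (dmod) dmod_scaleA
    dmod_scale1 dmod_scaleDr dmod_scaleDl.

Definition dif (a : dfield) : dmod := d (val a).

Lemma difD a b : dif (a + b) = dif a + dif b.
Proof. by rewrite /dif rmorphD /= (sc_add sc). Qed.

Lemma difM a b : dif (a * b) = a *: dif b + b *: dif a.
Proof.
rewrite /dif rmorphM /= (sc_leibniz sc) addrC.
by case/dcentralP: (dfieldP a) => _ <-.
Qed.

Lemma dfieldC (a : dfield) s : val a * s = s * val a.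
Proof. by case/dcentralP: (dfieldP a). Qed.

Lemma dcentral_d (a : dfield) s : s *: d (val a) = rm (d (val a)) s.
Proof. by case/dcentralP: (dfieldP a). Qed.

End DifferentialField.

Section BracketsAreDcentral.
Variables (R : realType) (h : R[i]) (disp : Order.disp_t) (I : orderType disp).
Variables (S : unitAlgType R[i]) (x y : I -> S) (K : set I) (T : set S).
Variables (M : lmodType S) (rm : M -> S -> M) (d : S -> M).
Hypothesis skew : is_skew_field S.
Hypothesis dr : differential_relations h x y K T rm d.
Hypothesis hp : hpoints h x y.
Hypothesis TC : forall t s, T t -> t * s = s * t.
Hypothesis gen : forall P : set S,
  (forall i, P (x i) /\ P (y i)) -> (forall t, T t -> P t) ->
  (forall c : R[i], P c%:A) -> (forall a b, P a -> P b -> P (a + b)) ->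
  (forall a b, P a -> P b -> P (a * b)) ->
  (forall a, a != 0 -> P a -> P a^-1) -> forall s, P s.

Definition dr_calculus :=
  SkewCalculus skew (dr_bimodule dr) (dr_add dr) (dr_leibniz dr).
Notation sc := dr_calculus.
Let bi := dr_bimodule dr.
Notation br i j := (bracket h (x i) (y i) (x j) (y j)).

(** Outside [K] both differentials vanish, so this commutation rule and the next three hold for
    every index [j]. *)
Lemma dx_x i j : rm (d (x j)) (x i) =
  x i *: d (x j) - (h *: x i) *: d (y j) + (h *: y i) *: d (x j)
  + (h ^+ 2 *: y i) *: d (y j).
Proof.
have [Kj|/(dr_const dr)[-> ->]] := pselect (K j); first exact: (dr_xx dr).
by rewrite !scaler0 (calculus_rm0 sc) subr0 !addr0.
Qed.

Lemma dy_y i j : rm (d (y j)) (y i) = y i *: d (y j).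
Proof.
have [Kj|/(dr_const dr)[_ ->]] := pselect (K j); first exact: (dr_yy dr).
by rewrite !scaler0 (calculus_rm0 sc).
Qed.

Lemma dx_y i j : rm (d (x j)) (y i) = y i *: d (x j) + (h *: y i) *: d (y j).
Proof.
have [Kj|/(dr_const dr)[-> ->]] := pselect (K j); first exact: (dr_xy dr).
by rewrite !scaler0 (calculus_rm0 sc) addr0.
Qed.

Lemma dy_x i j : rm (d (y j)) (x i) = x i *: d (y j) - (h *: y i) *: d (y j).
Proof.
have [Kj|/(dr_const dr)[_ ->]] := pselect (K j); first exact: (dr_yx dr).
by rewrite !scaler0 (calculus_rm0 sc) subr0.
Qed.

(** The elements commuting with [m] are closed under the ring operations and inverses, so the
    generators of the skew field decide. *)
Lemma commutant_gen m :
  (forall i, x i *: m = rm m (x i) /\ y i *: m = rm m (y i)) ->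
  (forall t, T t -> t *: m = rm m t) -> forall s, s *: m = rm m s.
Proof.
move=> mxy mT; apply: gen => //.
- by move=> c; rewrite (rmC bi).
- by move=> a b am bm; rewrite scalerDl am bm (rmDr bi).
- by move=> a b am bm; rewrite -scalerA bm -(rmZ bi) am (rmA bi).
move=> a a0 am; have aU := skew a0.
rewrite -[m in LHS](rm1 bi) -(mulrV aU) -(rmA bi) -am (rmZ bi) scalerA.
by rewrite mulVr // scale1r.
Qed.

Lemma central_gen z : (forall i, z * x i = x i * z /\ z * y i = y i * z) ->
  forall s, z * s = s * z.
Proof.
move=> zxy; apply: gen => //.
- by move=> t Tt; rewrite (TC _ Tt).
- by move=> c; rewrite -scalerAl -scalerAr mul1r mulr1.
- by move=> a b za zb; rewrite mulrDl mulrDr za zb.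
- by move=> a b za zb; rewrite mulrA za -mulrA zb mulrA.
move=> a a0 za; have aU := skew a0.
by apply: (mulIr aU); rewrite mulrVK // -mulrA za mulKr.
Qed.

(* In terms of [w_i = x_i / y_i] this is [y_i y_j d w_i] plus a multiple of
   [d y_i]; [d (br i j)] is its antisymmetrisation. *)
Let mu j i := y j *: d (x i) - (x j - h *: y j) *: d (y i).

Lemma mu_comm i j k :
  x k *: mu j i = rm (mu j i) (x k) /\ y k *: mu j i = rm (mu j i) (y k).
Proof.
(* Right multiplication by [s] is triangular on [X = d x_i], [Y = d y_i], of the form
   [X s = p X - q Y], [Y s = n Y]. Comparing coefficients leaves two identities in [S]. *)
have two (s p q a b n : S) (X Y : M) :
    s * a = a * p -> s * b = a * q + b * n ->
    s *: (a *: X - b *: Y) = a *: (p *: X - q *: Y) - b *: (n *: Y).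
  move=> sa sb; rewrite !scalerBr !scalerA sa sb [in LHS]scalerDl.
  by rewrite opprD addrA.
have xx : rm (d (x i)) (x k) =
    (x k + h *: y k) *: d (x i) - (h *: (x k - h *: y k)) *: d (y i).
  rewrite dx_x scalerDl scalerBr scalerA -expr2 scalerBl.
  by rewrite opprD opprK !addrA; congr (_ + _); rewrite addrAC.
have yx : rm (d (y i)) (x k) = (x k - h *: y k) *: d (y i).
  by rewrite dy_x scalerBl.
have xy : rm (d (x i)) (y k) = y k *: d (x i) - (- (h *: y k)) *: d (y i).
  by rewrite dx_y scaleNr opprK.
rewrite /mu; split; rewrite (rmDl bi) (calculus_rmN sc) !(rmZ bi).
  rewrite xx yx; apply: two; first by rewrite (hp_xy hp) mulrDr -scalerAr (hp_yy hp k j).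
  by rewrite -scalerAr scalerAl -mulrDl [h *: _ + _]addrC subrK (hp_xhx hp).
rewrite xy dy_y; apply: two; first exact: hp_yy hp _ _.
rewrite mulrBr mulrBl (hp_xy hp) mulrN -scalerAr -scalerAr -scalerAl (hp_yy hp k j).
by cancel_terms.
Qed.

Lemma d_bracket i j : d (br i j) = mu j i - mu i j.
Proof.
rewrite /bracket 2!(dr_add dr) !(calculus_dN sc) (dr_scale dr) !(dr_leibniz dr).
rewrite dx_y dy_x !dy_y /mu !scalerBl scalerDr !scalerA -!scalerAl !mul1r.
by cancel_terms.
Qed.

Lemma bracket_dcentral i j : br i j \in dcentral sc.
Proof.
have brC : forall s, br i j * s = s * br i j.
  by apply: central_gen => k; rewrite br_commx // br_commy.
apply/dcentralP; split=> //; apply: commutant_gen => [k|t Tt]; last first.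
  exact: (dr_central_l dr).
rewrite d_bracket; move: (mu_comm i j k) (mu_comm j i k).
move: (mu j i) (mu i j) => a b [xa ya] [xb yb].
by rewrite !scalerBr !(rmDl bi) !(calculus_rmN sc) xa ya xb yb.
Qed.

Lemma central_dcentral t : T t -> t \in dcentral sc.
Proof.
move=> Tt; apply/dcentralP; split=> [s|s]; first exact: TC.
exact: (dr_central_r dr).
Qed.

End BracketsAreDcentral.

Lemma homogeneous_prod_XsubC (F : fieldType) n (s : 'I_n -> F) (a b : F) :
  \sum_(i < n.+1) (\prod_(m < n) ('X - (s m)%:P))`_(n - i) * a ^+ (n - i) * b ^+ i =
  \prod_(m < n) (a - s m * b).
Proof.
set q := \prod_(m < n) _.
have szq : size q = n.+1 by rewrite size_prod_XsubC /index_enum -enumT size_enum_ord.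
have [->|b0] := eqVneq b 0.
  rewrite big_ord_recl big1 /= => [|i _]; last by rewrite exprS mul0r mulr0.
  have : q \is monic by apply: monic_prod_XsubC.
  rewrite monicE lead_coefE szq => /eqP /= q1.
  rewrite subn0 q1 addr0 mulr1 mul1r (eq_bigr (fun=> a)) ?prodr_const ?card_ord // => m _.
  by rewrite mulr0 subr0.
have : q.[a / b] * b ^+ n = \prod_(m < n) (a - s m * b).
  rewrite horner_prod -[n in b ^+ n]card_ord -prodr_const -big_split.
  by apply: eq_bigr => m _; rewrite /= hornerXsubC mulrBl divfK.
move=> <-; rewrite horner_coef szq mulr_suml [RHS](reindex_inj rev_ord_inj).
apply: eq_bigr => i _; rewrite /= subSS expr_div_n -!mulrA; congr (_ * (_ * _)).
have -> : b ^+ n = b ^+ (n - i) * b ^+ i by rewrite -exprD subnK // -ltnS.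
by rewrite mulKf // expf_neq0.
Qed.

Lemma poly_ext (F : fieldType) (p q : {poly F}) : [pchar F] =i pred0 ->
  (forall t, p.[t] = q.[t]) -> p = q.
Proof.
move=> char0 pq; apply/eqP; rewrite -subr_eq0; apply: contraT => pq0.
have := max_poly_roots pq0 (_ : all _ [seq i%:R | i <- iota 0 (size (p - q))]) _.
rewrite size_map size_iota ltnn => -> //.
  by apply/allP => t _; rewrite rootE !hornerE pq subrr.
rewrite map_inj_uniq ?iota_uniq // => m n /eqP.
wlog mn : m n / (m <= n)%N.
  by move=> W; case/orP: (leq_total m n) => [/W //|/W nm]; rewrite eq_sym => /nm.
rewrite eq_sym -subr_eq0 -natrB // (pcharf0P F).1 // subn_eq0 => nm.
by apply/eqP; rewrite eqn_leq mn.
Qed.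

Lemma wedge_root (F : fieldType) (a b e z : F) : a != 0 ->
  (1 * b - z * a) * e = - a * e * (z - b / a).
Proof. by move=> a0; field. Qed.

Lemma sign_invr (F : fieldType) (w v : F) : w ^+ 2 = v ^+ 2 ->
  (-1) ^+ (w != v) * w^-1 = v^-1.
Proof.
move/eqP; rewrite eqf_sqr; have [-> _|wv /= /eqP ->] := eqVneq w v; first by rewrite mul1r.
by rewrite expr1 invrN mulrNN mul1r.
Qed.

(** Multiplying [A P^2 = B Q^2] by [A] shows that [A B] is the square of [A P / Q]. The power of [a]
    accounts for rescaling a point to first coordinate 1 in [2 g + 2] brackets. *)
Lemma hyperelliptic_sqrt (F : fieldType) (g : nat) (a A B P Q : F) :
  Q != 0 -> A * P ^+ 2 = B * Q ^+ 2 ->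
  a ^+ (2 * g + 2) * (A * B) = (a ^+ g.+1 * (A * P) / Q) ^+ 2.
Proof.
move=> Q0 E; rewrite (_ : 2 * g + 2 = g.+1 * 2)%N; last lia.
rewrite exprM; move: (a ^+ g.+1) => b.
have -> : (b * (A * P) / Q) ^+ 2 = b ^+ 2 * A * (A * P ^+ 2) / Q ^+ 2 by field.
by rewrite E; field.
Qed.

(** The exponents [-(g + 1)], [g - 1] and 2 of [a] add up to zero: the differential depends only on
    the ratio of the homogeneous coordinates. *)
Lemma hyperelliptic_weight (F : fieldType) (g : nat) (a u q D e : F) :
  (0 < g)%N -> a != 0 -> q != 0 -> D != 0 ->
  (a ^+ g.+1 * D / q)^-1 * (a ^+ (g - 1) * u) * (- e * a ^+ 2) = - e * (u * (q / D)).
Proof.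
case: g => // g _ a0 q0 D0; rewrite subn1 /=.
have -> : a ^+ g.+2 = a ^+ g * a ^+ 2 by rewrite -exprD addn2.
have : a ^+ g != 0 by rewrite expf_neq0.
by move: (a ^+ g) => b b0; field; rewrite a0 D0 b0 q0.
Qed.

(** * Abel's theorem in coordinates over the differential field *)

Section AbelSum.
Variables (R : realType) (h : R[i]) (disp : Order.disp_t) (I : orderType disp).
Variables (S : unitAlgType R[i]) (x y : I -> S) (K : set I) (T : set S).
Variables (M : lmodType S) (rm : M -> S -> M) (d : S -> M).
Hypothesis skew : is_skew_field S.
Hypothesis dr : differential_relations h x y K T rm d.
Hypothesis hp : hpoints h x y.
Hypothesis TC : forall t s, T t -> t * s = s * t.
Hypothesis gen : forall P : set S,
  (forall i, P (x i) /\ P (y i)) -> (forall t, T t -> P t) ->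
  (forall c : R[i], P c%:A) -> (forall a b, P a -> P b -> P (a + b)) ->
  (forall a b, P a -> P b -> P (a * b)) ->
  (forall a, a != 0 -> P a -> P a^-1) -> forall s, P s.
Hypothesis br_neq0 : forall i j, i != j -> bracket h (x i) (y i) (x j) (y j) != 0.
Notation sc := (dr_calculus skew dr).
Notation F := (dfield sc).
Notation br i j := (bracket h (x i) (y i) (x j) (y j)).

Definition brF i j : F := DField (bracket_dcentral skew dr hp TC gen i j).

Variables p1 p2 : I.
Hypothesis p12 : p1 != p2.

Let e := brF p1 p2.
Let e0 : e != 0.
Proof. by rewrite -(inj_eq val_inj) rmorph0; apply: br_neq0. Qed.

(* Points are encoded by their coordinates with respect to [p1] and [p2]. *)
Definition xvec (z : F * F) : S := val z.1 * x p1 + val z.2 * x p2.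
Definition yvec (z : F * F) : S := val z.1 * y p1 + val z.2 * y p2.
Definition pt (i : I) : F * F := (brF i p2 / e, brF p1 i / e).
Definition wedge (z w : F * F) : F := (z.1 * w.2 - z.2 * w.1) * e.

Lemma vec_hpoints : hpoints h xvec yvec.
Proof. by apply: (comb_hpoints hp) => z a; apply: dfieldC. Qed.

Lemma bracket_vec z w : bracket h (xvec z) (yvec z) (xvec w) (yvec w) = val (wedge z w).
Proof.
pose u (z : F * F) := val z.1; pose v (z : F * F) := val z.2.
have uC z' a : u z' * a = a * u z' by apply: dfieldC.
have vC z' a : v z' * a = a * v z' by apply: dfieldC.
have -> := comb_bracket hp p1 p2 uC vC z w.
by rewrite /wedge rmorphM rmorphB !rmorphM.
Qed.

Lemma pt_vec i : xvec (pt i) = x i /\ yvec (pt i) = y i.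
Proof.
have eU : val e \is a GRing.unit by apply: skew; apply: br_neq0.
have eX : br p1 p2 * x i = br i p2 * x p1 + br p1 i * x p2 by apply: pluecker_x.
have eY : br p1 p2 * y i = br i p2 * y p1 + br p1 i * y p2 by apply: pluecker_y.
have main (z z1 z2 : S) : br p1 p2 * z = br i p2 * z1 + br p1 i * z2 ->
    val (pt i).1 * z1 + val (pt i).2 * z2 = z.
  have eM (a : F) : val e * val (a / e) = val a by rewrite -rmorphM mulrC divfK.
  move=> E; apply: (mulrI eU); rewrite mulrDr E.
  by congr (_ + _); rewrite mulrA; congr (_ * _); apply: eM.
by split; apply: main.
Qed.

Lemma wedge_pt i j : wedge (pt i) (pt j) = brF i j.
Proof.
apply: val_inj; rewrite -bracket_vec.
by have [-> ->] := pt_vec i; have [-> ->] := pt_vec j.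
Qed.

Lemma wedge_pt_neq0 i j : i != j -> wedge (pt i) (pt j) != 0.
Proof.
by move=> ij; rewrite wedge_pt -(inj_eq val_inj) rmorph0; apply: br_neq0.
Qed.

Lemma wedge_p2 i : wedge (0, 1) (pt i) = brF p2 i.
Proof.
rewrite -wedge_pt; congr wedge; rewrite /pt /e; congr (_, _); last by rewrite divff.
by apply/esym; apply/eqP; rewrite mulf_eq0 -(inj_eq val_inj) rmorph0 /= (br_diag hp) eqxx.
Qed.

Lemma char0_dfield : [pchar F] =i pred0.
Proof.
apply/pcharf0P => n; apply/eqP/eqP => [/(congr1 val)|->//].
rewrite rmorph_nat rmorph0 => n0; apply/eqP; move/eqP: n0.
by rewrite -(scaler_nat n 1) scaler_eq0 oner_eq0 orbF pnatr_eq0.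
Qed.

Lemma wedge_p1 i : wedge (1, 0) (pt i) = brF p1 i.
Proof. by rewrite /wedge /= mul0r subr0 mul1r /pt divfK. Qed.

Lemma dif_brF i j : ~ K i -> ~ K j -> dif (brF i j) = 0.
Proof.
move=> /(dr_const dr)[xi yi] /(dr_const dr)[xj yj].
rewrite /dif /= /bracket 2!(dr_add dr) !(calculus_dN sc) (dr_scale dr) !(dr_leibniz dr).
by rewrite xi yi xj yj !(calculus_rm0 sc, scaler0, addr0, oppr0).
Qed.

Lemma wedge_common_zero z v w : wedge v w != 0 ->
  wedge z v = 0 -> wedge z w = 0 -> z.1 = 0 /\ z.2 = 0.
Proof.
move=> vw zv zw; split; apply: (mulIf vw); rewrite mul0r.
  have -> : z.1 * wedge v w = v.1 * wedge z w - w.1 * wedge z v by rewrite /wedge; ring.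
  by rewrite zv zw !mulr0 subr0.
have -> : z.2 * wedge v w = v.2 * wedge z w - w.2 * wedge z v by rewrite /wedge; ring.
by rewrite zv zw !mulr0 subr0.
Qed.

Lemma wedge_scale a z w : wedge (a * z.1, a * z.2) w = a * wedge z w.
Proof. by rewrite /wedge /=; ring. Qed.

Definition linpoly (i : I) : {poly F} :=
  (wedge (1, 0) (pt i))%:P + wedge (0, 1) (pt i) *: 'X.

Lemma horner_linpoly i t : (linpoly i).[t] = wedge (1, t) (pt i).
Proof. by rewrite /linpoly !hornerE /wedge /=; ring. Qed.

(** The coefficients are the brackets of [i] with [p1] and [p2], constant because all three indices
    lie outside [K]. *)
Lemma difconst_linpoly i : ~ K p1 -> ~ K p2 -> ~ K i ->
  difconst (@dif _ _ _ _ _ sc) (linpoly i).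
Proof.
move=> K1 K2 Ki; rewrite /linpoly wedge_p1 wedge_p2.
by apply: difconst_linear; [apply: difD|apply: difM|apply: dif_brF|apply: dif_brF].
Qed.

Lemma size_prod_linpoly n (c_ : 'I_n -> I) :
  (size (\prod_(m < n) linpoly (c_ m))%R <= n.+1)%N.
Proof.
have sl i : (size (linpoly i) <= 2)%N.
  rewrite (leq_trans (size_polyD _ _)) // geq_max (leq_trans (size_polyC_leq1 _)) //=.
  by rewrite (leq_trans (size_scale_leq _ _)) // size_polyX.
elim: n c_ => [|n IH] c_; first by rewrite big_ord0 size_poly1.
rewrite big_ord_recl (leq_trans (size_polyMleq _ _)) //.
by move: (sl (c_ ord0)) (IH (fun m => c_ (lift ord0 m))); lia.
Qed.

(** As [p1] and [p2] are constant, [(dX, X)] is a combination of [d z.1] and [d z.2] whose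
    coefficients are the brackets of [p1] and [p2] with the point [z]. This gives
    [e (z.2 d z.1 - z.1 d z.2)], and the quotient rule does the rest. *)
Lemma dbracket_vec z : ~ K p1 -> ~ K p2 -> z.1 != 0 ->
  dbracket h rm d (xvec z) (yvec z) = val (- e * z.1 ^+ 2) *: (dif (z.2 / z.1) : M).
Proof.
move=> /(dr_const dr)[x1 y1] /(dr_const dr)[x2 y2] z1.
have dvec (X1 X2 : S) : d X1 = 0 -> d X2 = 0 ->
    d (val z.1 * X1 + val z.2 * X2) = X1 *: d (val z.1) + X2 *: d (val z.2).
  move=> dX1 dX2; rewrite (dr_add dr) !(dr_leibniz dr) dX1 dX2 !scaler0 !addr0.
  by rewrite !dcentral_d.
rewrite /dbracket /xvec /yvec !dvec // -/(xvec z) -/(yvec z).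
have rmvec (X1 X2 Y : S) : rm (X1 *: d (val z.1) + X2 *: d (val z.2)) Y =
    (X1 * Y) *: d (val z.1) + (X2 * Y) *: d (val z.2).
  by rewrite (rmDl (dr_bimodule dr)) !(rmZ (dr_bimodule dr)) -!dcentral_d !scalerA.
have vec10 : xvec (1, 0) = x p1 /\ yvec (1, 0) = y p1.
  by rewrite /xvec /yvec rmorph1 rmorph0 !mul1r !mul0r !addr0.
have vec01 : xvec (0, 1) = x p2 /\ yvec (0, 1) = y p2.
  by rewrite /xvec /yvec rmorph1 rmorph0 !mul1r !mul0r !add0r.
transitivity (bracket h (x p1) (y p1) (xvec z) (yvec z) *: d (val z.1) +
              bracket h (x p2) (y p2) (xvec z) (yvec z) *: d (val z.2)).
  rewrite !rmvec /bracket scalerDr !scalerA !scalerBl.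
  have -> (a b : S) : h%:A * (a * b) = h *: (a * b) by rewrite -scalerAl mul1r.
  have -> (a b : S) : h%:A * (a * b) = h *: (a * b) by rewrite -scalerAl mul1r.
  by cancel_terms.
have [<- <-] := vec10; have [<- <-] := vec01; rewrite !bracket_vec.
have -> : wedge (1, 0) z = e * z.2 by rewrite /wedge /=; ring.
have -> : wedge (0, 1) z = - e * z.1 by rewrite /wedge /=; ring.
suff E : (- e * z.1 ^+ 2) *: dif (z.2 / z.1) =
    (e * z.2) *: dif z.1 + (- e * z.1) *: dif z.2.
  by rewrite -[RHS]/((- e * z.1 ^+ 2) *: dif (z.2 / z.1)) E.
rewrite (dif_div (@difM _ _ _ _ _ sc)) // scalerA mulfK ?expf_neq0 //.
by rewrite scalerBr !scalerA addrC -scaleNr mulNr opprK.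
Qed.

Variables (N g s p q : nat) (i_ : 'I_N -> I) (j_ : 'I_(g - 1) -> I).
Variables (k_ : 'I_p -> I) (l_ : 'I_q -> I).
Hypotheses (ij : injective i_) (ik : forall m n, i_ m != k_ n).
Hypotheses (il : forall m n, i_ m != l_ n) (kl : forall m n, k_ m != l_ n).
Hypothesis iK : forall m, ~ K (i_ m).
Hypotheses (g1 : (1 <= g)%N) (Ng : N = (2 * g + 2)%N) (pq : (p + s = q + g + 1)%N).
Variables m1 m2 : 'I_N.
Hypotheses (p1E : p1 = i_ m1) (p2E : p2 = i_ m2).

Let fA z := \prod_(m < N | (m < s)%N) wedge z (pt (i_ m)).
Let fB z := \prod_(m < N | (s <= m)%N) wedge z (pt (i_ m)).
Let fP z := \prod_(m < p) wedge z (pt (k_ m)).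
Let fQ z := \prod_(m < q) wedge z (pt (l_ m)).
Let fU z := \prod_(m < g - 1) wedge z (pt (j_ m)).

Definition form_at (z : F * F) : F := fA z * fP z ^+ 2 - fB z * fQ z ^+ 2.

(** Here [(0, 1)] stands for [p2 = i_ m2]. It kills exactly one of the two summands, and the factors
    of the other are brackets with points different from [p2]. Thus [p2] can serve as the point at
    infinity. *)
Lemma form_at_p2 : form_at (0, 1) != 0.
Proof.
have w0 : wedge (0, 1) (pt (i_ m2)) = 0.
  by apply: val_inj; rewrite wedge_p2 -p2E; apply: (br_diag hp).
have wn i : i != i_ m2 -> wedge (0, 1) (pt i) != 0.
  by rewrite wedge_p2 -wedge_pt -p2E eq_sym; apply: wedge_pt_neq0.
rewrite /form_at; case: (ltnP m2 s) => m2s.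
  rewrite [fA _](bigD1 m2) //= w0 !mul0r sub0r oppr_eq0 mulf_eq0 negb_or expf_eq0 /=.
  apply/andP; split; apply/prodf_neq0 => m sm; apply: wn; last by rewrite eq_sym.
  by rewrite (inj_eq ij); apply: contraTneq sm => ->; rewrite -ltnNge.
rewrite [fB _](bigD1 m2) //= w0 !mul0r subr0 mulf_eq0 negb_or expf_eq0 /=.
apply/andP; split; apply/prodf_neq0 => m sm; apply: wn; last by rewrite eq_sym.
by rewrite (inj_eq ij); apply: contraTneq sm => ->; rewrite -leqNgt.
Qed.

(** If [A] or [P] vanished at [z], then so would [B] or [Q], and [z] would have zero bracket with
    two different points, forcing [z = 0]. If [Q] vanished, then [A] or [P] would. *)
Lemma form_at_root z : z.1 != 0 -> form_at z = 0 -> fA z * fP z != 0 /\ fQ z != 0.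
Proof.
move=> z1 r0.
have ABPQ : fA z * fP z ^+ 2 = fB z * fQ z ^+ 2 by apply/eqP; rewrite -subr_eq0; apply/eqP.
have no i k : i != k -> wedge z (pt i) = 0 -> wedge z (pt k) = 0 -> False.
  move=> /wedge_pt_neq0 W wi wk; have [z10 _] := wedge_common_zero W wi wk.
  by move: z1; rewrite z10 eqxx.
have AP0 : (fA z == 0) || (fP z == 0) -> False.
  move=> ap0; have : fB z * fQ z ^+ 2 == 0.
    by rewrite -ABPQ mulf_eq0 expf_eq0.
  rewrite mulf_eq0 expf_eq0 /= => bq0.
  case/orP: ap0 => /prodf_eq0[m ms /eqP w0]; case/orP: bq0 => /prodf_eq0[n ns /eqP w0'].
  - apply: no w0 w0'; rewrite (inj_eq ij); apply: contraTneq ms => ->.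
    by rewrite -leqNgt.
  - exact: no (il _ _) w0 w0'.
  - exact: no (ik _ _) w0' w0.
  - exact: no (kl _ _) w0 w0'.
split; first by rewrite mulf_eq0; apply/negP.
apply/negP => /eqP Q0; apply: AP0; move: ABPQ; rewrite Q0 expr0n mulr0 => /eqP.
by rewrite mulf_eq0 expf_eq0.
Qed.

Variables (k : nat) (zs : 'I_k -> F * F) (C : F) (W : 'I_k -> F).
Hypothesis kE : k = (s + 2 * p)%N.
Hypothesis formE : forall z, form_at z = C * \prod_n wedge z (zs n).
Hypothesis W_sqr : forall n, W n ^+ 2 = \prod_m wedge (zs n) (pt (i_ m)).

Lemma zs1_neq0 n : (zs n).1 != 0.
Proof.
apply: contraNneq form_at_p2 => z0; rewrite formE (bigD1 n) //= {1}/wedge /= z0.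
by rewrite mulr0 mul0r subr0 mul0r mul0r mulr0.
Qed.

Let t n := (zs n).2 / (zs n).1.

Lemma wedge_zs n w : wedge (zs n) w = (zs n).1 * wedge (1, t n) w.
Proof.
rewrite -wedge_scale mulr1 mulrC divfK ?zs1_neq0 //; by case: (zs n).
Qed.

Lemma form_at_t n : form_at (1, t n) = 0.
Proof.
rewrite formE (bigD1 n) //= {1}/wedge /= [X in X * e](_ : _ = 0) ?mul0r ?mulr0 //.
by rewrite mul1r divfK ?subrr // zs1_neq0.
Qed.

Lemma fA_root n : fA (1, t n) * fP (1, t n) != 0 /\ fQ (1, t n) != 0.
Proof.
by apply: form_at_root; rewrite ?oner_neq0 // form_at_t.
Qed.

Lemma abel_residue_sum :
  \sum_n (fU (1, t n) * (fQ (1, t n) / (fA (1, t n) * fP (1, t n)))) *: dif (t n) = 0.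
Proof.
pose pA := \prod_(m < N | (m < s)%N) linpoly (i_ m).
pose pB := \prod_(m < N | (s <= m)%N) linpoly (i_ m).
pose pP := \prod_(m < p) linpoly (k_ m).
pose pQ := \prod_(m < q) linpoly (l_ m).
pose pU := \prod_(m < g - 1) linpoly (j_ m).
have hprod (J : finType) (P : pred J) (c_ : J -> I) z :
    (\prod_(m | P m) linpoly (c_ m)).[z] = \prod_(m | P m) wedge (1, z) (pt (c_ m)).
  by rewrite horner_prod; apply: eq_bigr => m _; apply: horner_linpoly.
(* The leading coefficient: as a function of [z], the bracket of [(1, z)] with [zs n] is
   [- (zs n).1 e (z - t n)]. *)
pose c := C * \prod_n (- (zs n).1 * e).
have c0 : c != 0.
  rewrite mulf_neq0 //; last first.
    by apply/prodf_neq0 => n _; rewrite mulf_neq0 // oppr_eq0 zs1_neq0.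
  by apply: contra_neq form_at_p2 => C0; rewrite formE C0 mul0r.
have dc (P : pred 'I_N) : difconst (@dif _ _ _ _ _ sc) (\prod_(m | P m) linpoly (i_ m)).
  elim/big_rec: _ => [|m f _ df].
    exact: difconst1 (@difD _ _ _ _ _ sc) (@difM _ _ _ _ _ sc).
  apply: (difconstM (@difD _ _ _ _ _ sc) (@difM _ _ _ _ _ sc)) => //.
  by apply: difconst_linpoly => //; rewrite ?p1E ?p2E.
have := @abel_identity F (dmod_of sc) (@dif _ _ _ _ _ sc)
  (@difD _ _ _ _ _ sc) (@difM _ _ _ _ _ sc)
  pA pB pP pQ pU k t c c0.
have rhoE : pA * pP ^+ 2 - pB * pQ ^+ 2 = c *: \prod_(n < k) ('X - (t n)%:P).
  apply: (poly_ext char0_dfield) => z.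
  rewrite hornerZ horner_prod !(hornerD, hornerN, hornerM, horner_exp) !hprod.
  rewrite -[LHS]/(form_at (1, z)) formE /c -mulrA -big_split; congr (_ * _).
  apply: eq_bigr => n _; rewrite /= hornerXsubC /wedge /= /t.
  exact: wedge_root (zs1_neq0 n).
move/(_ rhoE (dc _) (dc _)); rewrite /pU /pP /pQ.
(* The sizes are at most [g], [p + 1] and [q + 1], and [k + 1 = p + q + g + 2], so the degree bound
   is met exactly. The number [g - 1] of points [j_] and the relation between [p], [q] and [s] enter
   here. *)
have szs : (size pU + size pP + size pQ <= k.+1)%N.
  have := size_prod_linpoly j_; have := size_prod_linpoly k_; have := size_prod_linpoly l_.
  rewrite -/pU -/pP -/pQ; move: pq kE g1; lia.
move/(_ szs) => H; rewrite -[RHS]H => [|n|n].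
- by apply: eq_bigr => n _; rewrite hornerM !hprod.
- by rewrite hornerM !hprod; case: (fA_root n).
- by rewrite hprod; case: (fA_root n).
Qed.

Lemma abel_hyperelliptic_sum : exists eps : 'I_k -> bool,
  \sum_n (-1) ^+ eps n *:
    hyperelliptic_differential h rm d (fun m => x (j_ m)) (fun m => y (j_ m))
      (val (W n)) (xvec (zs n)) (yvec (zs n)) = 0.
Proof.
(* The rational square root of the product of brackets at [zs n]. It agrees with [W n] up to sign,
   and the sign is recorded by whether the two differ. *)
pose V n := (zs n).1 ^+ g.+1 * (fA (1, t n) * fP (1, t n)) / fQ (1, t n).
exists (fun n => W n != V n).
have hyp n : hyperelliptic_differential h rm d (fun m => x (j_ m)) (fun m => y (j_ m))
      (val (W n)) (xvec (zs n)) (yvec (zs n)) =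
    (((W n)^-1 * fU (zs n) * (- e * (zs n).1 ^+ 2)) *: dif (t n) : dmod_of sc).
  rewrite /hyperelliptic_differential dbracket_vec ?p1E ?p2E ?zs1_neq0 // scalerA.
  rewrite -[RHS]/(val ((W n)^-1 * fU (zs n) * (- e * (zs n).1 ^+ 2)) *: (dif (t n) : M)).
  congr (_ *: _); rewrite [in RHS]rmorphM [in RHS]rmorphM fmorphV rmorph_prod.
  congr (_ * _ * _); apply: eq_bigr => m _.
  by have [xj yj] := pt_vec (j_ m); rewrite -{1}xj -{1}yj; apply: bracket_vec.
have main n : (-1) ^+ (W n != V n) * ((W n)^-1 * fU (zs n) * (- e * (zs n).1 ^+ 2)) =
    - e * (fU (1, t n) * (fQ (1, t n) / (fA (1, t n) * fP (1, t n)))).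
  have [AP0 Q0] := fA_root n; have a0 := zs1_neq0 n.
  have ABPQ : fA (1, t n) * fP (1, t n) ^+ 2 = fB (1, t n) * fQ (1, t n) ^+ 2.
    by apply/eqP; rewrite -subr_eq0; apply/eqP; apply: form_at_t.
  have WV : W n ^+ 2 = V n ^+ 2.
    rewrite W_sqr (eq_bigr (fun m => (zs n).1 * wedge (1, t n) (pt (i_ m)))) => [|m _];
      last exact: wedge_zs.
    rewrite big_split prodr_const card_ord /= (bigID (fun m : 'I_N => (m < s)%N)) /=.
    rewrite -/(fA (1, t n)) (eq_bigl (fun m : 'I_N => (s <= m)%N)) => [|m];
      last by rewrite -leqNgt.
    by rewrite -/(fB (1, t n)) /V {1}Ng; apply: hyperelliptic_sqrt.
  have fUE : fU (zs n) = (zs n).1 ^+ (g - 1) * fU (1, t n).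
    rewrite /fU -[in X in _ ^+ X](card_ord (g - 1)) -prodr_const -big_split.
    by apply: eq_bigr => m _; apply: wedge_zs.
  transitivity (((-1) ^+ (W n != V n) * (W n)^-1) * fU (zs n) * (- e * (zs n).1 ^+ 2)).
    by rewrite !mulrA.
  by rewrite sign_invr // fUE; apply: hyperelliptic_weight.
transitivity (- e *: (\sum_n
  (fU (1, t n) * (fQ (1, t n) / (fA (1, t n) * fP (1, t n)))) *: dif (t n)) : M).
  rewrite scaler_sumr; apply: eq_bigr => n _; rewrite hyp.
  rewrite [RHS]scalerA -main -[RHS]scalerA; congr (_ *: _).
  by rewrite rmorphXn rmorphN rmorph1.
by rewrite abel_residue_sum scaler0.
Qed.

End AbelSum.

(** * The linear factors of [r] *)

Lemma hpoints_morph (R : realType) (h : R[i]) (I : Type) (A B : algType R[i])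
    (f : {lrmorphism A -> B}) (x y : I -> A) :
  hpoints h x y -> hpoints h (fun i => f (x i)) (fun i => f (y i)).
Proof.
move=> hp i j; have [yy xy xx] := hp i j; split.
- by rewrite -!rmorphM yy.
- by rewrite -!rmorphM xy raddfD /=; congr (_ + _); rewrite linearZ.
have E k : f (x k) - h *: f (y k) = f (x k - h *: y k).
  by rewrite raddfB /=; congr (_ - _); rewrite linearZ.
by rewrite !E -!rmorphM xx.
Qed.

Lemma skew_field_morph_inj (R : realType) (A : unitAlgType R[i]) (B : algType R[i])
    (f : {lrmorphism A -> B}) : is_skew_field A -> injective f.
Proof.
move=> skew; apply: raddf_inj => a fa0; apply/eqP; apply: contraT => /skew aU.
by have := oner_neq0 B; rewrite -(rmorph1 f) -(mulrV aU) rmorphM /= fa0 mul0r eqxx.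
Qed.

Section Polarization.
Variables (R : realType) (h : R[i]) (disp : Order.disp_t) (I : orderType disp).
Variables (H : algType R[i]) (x y : I -> H) (isH : is_HI h x y).
Variables (o a : I) (D : {linear H -> H}) (isD : is_Delta x y o a D).
Notation br i j := (bracket h (x i) (y i) (x j) (y j)).

Lemma Delta_scalar (c : R[i]) : D c%:A = 0.
Proof.
have [DM _ _] := isD; have D1 : D 1 = 0.
  by apply: (@addrI _ (D 1)); rewrite addr0 -[in RHS](mulr1 1) DM mulr1 mul1r.
by rewrite linearZ /= D1 scaler0.
Qed.

Lemma Delta_HJ v : HJ x y (~` [set o]) v -> D v = 0.
Proof.
have [DM _ D0] := isD; elim=> {v} [v [i io [->|->]]|c|u v _ Du _ Dv|u v _ Du _ Dv].
- by case: (D0 i) => //; apply/eqP.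
- by case: (D0 i) => //; apply/eqP.
- exact: Delta_scalar.
- by rewrite raddfD /= Du Dv addr0.
by rewrite DM Du Dv mul0r mulr0 addr0.
Qed.

Lemma Delta_bracketM X Y X' Y' : D (bracket h X Y X' Y') =
  bracket h (D X) (D Y) X' Y' + bracket h X Y (D X') (D Y').
Proof.
have [DM _ _] := isD; rewrite /bracket 2!raddfB /= linearZ /= !DM scalerDr.
by cancel_terms.
Qed.

Lemma brackets_Delta v : subalg (brackets h x y) v -> subalg (brackets h x y) (D v).
Proof.
have [DM [Dx Dy] D0] := isD.
have s0 : subalg (brackets h x y) 0 by rewrite -(scale0r 1); apply: subalg_scalar.
have DE i : (D (x i) = 0 /\ D (y i) = 0) \/ (D (x i) = x a /\ D (y i) = y a).
  by have [->|/D0] := eqVneq i o; [right|left].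
elim=> {v} [v [i [j ->]]|c|u v _ Du _ Dv|u v Gu Du Gv Dv].
- rewrite Delta_bracketM; apply: subalg_add.
    case: (DE i) => -[-> ->]; last exact: brackets_subalg.
    by rewrite /bracket !mul0r scaler0 !subr0.
  case: (DE j) => -[-> ->]; last exact: brackets_subalg.
  by rewrite /bracket !mulr0 scaler0 !subr0.
- by rewrite Delta_scalar.
- by rewrite raddfD; apply: subalg_add.
by rewrite DM; apply: subalg_add; apply: subalg_mul.
Qed.

(** Polarisation replaces the point [o] by [a] in one bracket at a time. Hence xi and [f_a] are
    polynomials in brackets and will lie in the differential field. *)
Lemma brackets_polar n m v : subalg (brackets h x y) v ->
  subalg (brackets h x y) (polar D n m v).
Proof. by move=> bv; elim: m => //= m IH; apply: subalgZ; apply: brackets_Delta. Qed.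

(** xi is linear in the point [o], and the last polarisation has denominator 1, so it just replaces
    this point by [a]. This second bracket with [(gam, del)] complements xi for Cramer's rule. *)
Lemma polar_top n f gam del : (0 < n)%N ->
  HJ x y (~` [set o]) gam -> HJ x y (~` [set o]) del ->
  polar D n n.-1 f = bracket h (x o) (y o) gam del ->
  polar D n n f = bracket h (x a) (y a) gam del.
Proof.
have [_ [Dx Dy] _] := isD.
case: n => // n _ /Delta_HJ Dg /Delta_HJ Dd /= ->.
rewrite subSn // subnn invr1 scale1r Delta_bracketM Dx Dy Dg Dd.
by rewrite /bracket !mulr0 scaler0 !subr0 addr0.
Qed.

End Polarization.

Lemma polynomial_family_coef (A : nzRingType) n (c : 'I_n.+1 -> A) (i : 'I_n.+1) :
  (\sum_(m < n.+1) (c m)%:P * 'X^(n - m))`_(n - i) = c i.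
Proof.
rewrite coef_sum (bigD1 i) //= coefCM coefXn eqxx mulr1 big1 ?addr0 // => m mi.
rewrite coefCM coefXn; case: eqP => [|_]; last by rewrite mulr0.
move=> E; case/eqP: mi; apply: val_inj => /=.
by move: E (ltn_ord m) (ltn_ord i); lia.
Qed.

Section FactorData.
Variables (R : realType) (h : R[i]) (disp : Order.disp_t) (I : orderType disp).
Variables (H : algType R[i]) (x y : I -> H) (isH : is_HI h x y).
Variables (UH : Uh_module_algebra h H) (o : I).
Variables (Q : unitAlgType R[i]) (j : {lrmorphism H -> Q}).
Hypothesis isQ : right_quotient_skew_field j.
Variables (UQ : Uh_module_algebra h Q) (QS : unitAlgType R[i]).
Variables (iota : {lrmorphism Q -> QS}) (US : Uh_module_algebra h QS).
Variables (a : I) (D : {linear H -> H}) (gam del : H) (k : nat) (u : 'I_k.+1 -> H).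
Variables (Sigma : fieldType) (kappa : {rmorphism Sigma -> QS}) (sigma : 'I_k -> Sigma).
Variables (r : H) (r0 : r != 0).
Hypothesis fact : factor_data x y UH o j UQ iota US r a D gam del u kappa sigma.

Lemma fact_polar_top : polar D k k r = bracket h (x a) (y a) gam del.
Proof.
by case: fact => k0 ao _ isD Hg Hd xiE *; apply: (polar_top isD k0 Hg Hd xiE).
Qed.

Lemma fact_fa : fa fact = j (polar D k k r). Proof. by case: fact. Qed.
Lemma fact_Cf : Cf fact = j (polar D k k r) ^- k.-1. Proof. by case: fact. Qed.
Lemma fact_xi : xi fact = j (bracket h (x o) (y o) gam del).
Proof. by rewrite -(fd_xi fact); case: fact. Qed.
Lemma fact_eta : Defs.eta fact = j (bracket h (x o) (y o) (x a) (y a)).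
Proof. by case: fact. Qed.

Lemma fact_expansionQ : j r = j (polar D k k r) ^- k *
  \sum_(i < k.+1) j (bracket h (x o) (y o) gam del) ^+ (k - i) *
     j (bracket h (x o) (y o) (x a) (y a)) ^+ i * j (u i).
Proof. by rewrite (fd_f_u fact) fact_fa fact_xi fact_eta. Qed.

(** With the convention that the inverse of 0 is 0, a vanishing [f_a] would make the expansion of r
    zero. *)
Lemma fact_fa_neq0 : j (polar D k k r) != 0.
Proof.
have [_ jinj _] := isQ; move: r0; apply: contraNneq => fa0.
have k0 := fd_n_gt0 fact; apply/eqP; apply: jinj.
by rewrite rmorph0 fact_expansionQ fa0 expr0n eqn0Ngt k0 invr0 mul0r.
Qed.

(** Denominators are cleared so that the identity lives in [H_I]: the morphisms that move the point
    [o] are defined there and need not extend to [Q_I]. *)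
Lemma fact_expansion : polar D k k r ^+ k * r =
  \sum_(i < k.+1) bracket h (x o) (y o) gam del ^+ (k - i) *
     bracket h (x o) (y o) (x a) (y a) ^+ i * u i.
Proof.
have [skQ jinj _] := isQ; apply: jinj.
transitivity (j (polar D k k r) ^+ k * j r); first by rewrite rmorphM rmorphXn.
rewrite fact_expansionQ mulVKr ?unitrX ?skQ ?fact_fa_neq0 //.
by rewrite rmorph_sum; apply: eq_bigr => i _; rewrite !rmorphM !rmorphXn.
Qed.

Lemma fact_coef (i : 'I_k.+1) : iota (j (polar D k k r) ^- k * j (u i)) =
  ((iota (j (polar D k k r) ^- k.-1))%:P *
   \prod_(m < k) ('X - (kappa (sigma m))%:P))`_(k - i).
Proof.
rewrite -(polynomial_family_coef (fun i => iota (j (polar D k k r) ^- k * j (u i)))).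
by rewrite -fact_fa (fd_split fact) fact_Cf fact_fa.
Qed.

End FactorData.

(** The skew field is generated by the points, the sigma's and the root elements. Inverses enter
    only through the fractions of [Q_I], both later extensions being generated as rings. *)
Lemma quotient_tower_ind (R : realType) (disp : Order.disp_t) (I : orderType disp)
    (h : R[i]) (H : algType R[i]) (x y : I -> H) (Q QS QSW : unitAlgType R[i])
    (j : {lrmorphism H -> Q}) (iota : {lrmorphism Q -> QS})
    (iotaW : {lrmorphism QS -> QSW}) (n m : nat) (s : 'I_n -> QS) (w : 'I_m -> QSW) :
  is_HI h x y -> right_quotient_skew_field j -> central_skew_extension iota s ->
  central_skew_extension iotaW w ->
  forall P : set QSW,
  (forall i, P (iotaW (iota (j (x i)))) /\ P (iotaW (iota (j (y i))))) ->
  (forall t, ((exists i, t = iotaW (s i)) \/ exists i, t = w i) -> P t) ->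
  (forall c : R[i], P c%:A) -> (forall a b, P a -> P b -> P (a + b)) ->
  (forall a b, P a -> P b -> P (a * b)) ->
  (forall a, a != 0 -> P a -> P a^-1) -> forall z, P z.
Proof.
move=> [_ genH _] [skQ jinj genQ] [skS _ genS] [_ _ genW] P Pxy Pt Pc PD PM PV.
have PH a : P (iotaW (iota (j a))).
  elim: (genH a) => {a} [a [i _ [->|->]]|c|a b _ Pa _ Pb|a b _ Pa _ Pb].
  - by case: (Pxy i).
  - by case: (Pxy i).
  - by rewrite linearZ /= rmorph1 linearZ /= rmorph1 linearZ /= rmorph1; apply: Pc.
  - by rewrite raddfD /= raddfD /= raddfD; apply: PD.
  by rewrite !rmorphM; apply: PM.
have PQ a : P (iotaW (iota a)).
  have [b [c [c0 ->]]] := genQ a.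
  have jc0 : j c != 0 by rewrite raddf_eq0.
  have ic0 : iota (j c) != 0 by rewrite raddf_eq0 //; apply: skew_field_morph_inj.
  rewrite !rmorphM; apply: PM; first exact: PH.
  rewrite !rmorphV ?skQ ?skS //; apply: PV; last exact: PH.
  by rewrite raddf_eq0 //; apply: skew_field_morph_inj.
have PS a : P (iotaW a).
  elim: (genS a) => {a} [a [[b ->]|[i ->]]|c|a b _ Pa _ Pb|a b _ Pa _ Pb].
  - exact: PQ.
  - by apply: Pt; left; exists i.
  - by rewrite linearZ /= rmorph1; apply: Pc.
  - by rewrite raddfD; apply: PD.
  by rewrite rmorphM; apply: PM.
move=> z; elim: (genW z) => {z} [a [[b ->]|[i ->]]|c|a b _ Pa _ Pb|a b _ Pa _ Pb] //.
- by apply: Pt; right; exists i.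
- exact: PD.
exact: PM.
Qed.

Lemma central_extension_comm (R : realType) (A B : unitAlgType R[i])
    (f : {lrmorphism A -> B}) n (w : 'I_n -> B) (a : A) :
  central_skew_extension f w -> (forall b, a * b = b * a) ->
  forall z, f a * z = z * f a.
Proof.
move=> [_ wC gen] aC z.
elim: (gen z) => {z} [b [[c ->]|[i ->]]|c|b c _ Pb _ Pc|b c _ Pb _ Pc].
- by rewrite -!rmorphM aC.
- by rewrite wC.
- by rewrite -scalerAl -scalerAr mul1r mulr1.
- by rewrite mulrDl mulrDr Pb Pc.
by rewrite mulrA Pb -mulrA Pc mulrA.
Qed.

Lemma brackets_dcentral (R : realType) (h : R[i]) (disp : Order.disp_t)
    (I : orderType disp) (H : algType R[i]) (x y : I -> H) (S : unitAlgType R[i])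
    (M : lmodType S) (rm : M -> S -> M) (d : S -> M) (sc : skew_calculus rm d)
    (f : {lrmorphism H -> S}) :
  (forall i j, f (bracket h (x i) (y i) (x j) (y j)) \in dcentral sc) ->
  (forall c : R[i], d c%:A = 0) ->
  forall a, subalg (brackets h x y) a -> f a \in dcentral sc.
Proof.
move=> fb dA a; elim=> {a} [a [i [j ->]] //|c|a b _ fa _ fb'|a b _ fa _ fb'].
- rewrite linearZ /= rmorph1; apply/dcentralP; split=> s.
    by rewrite -scalerAl -scalerAr mul1r mulr1.
  by rewrite dA scaler0 (calculus_rm0 sc).
- by rewrite raddfD; apply: rpredD.
by rewrite rmorphM; apply: rpredM.
Qed.

Lemma dfield_vecB (R : realType) (S : unitAlgType R[i]) (M : lmodType S)
    (rm : M -> S -> M) (d : S -> M) (sc : skew_calculus rm d)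
    (X1 X2 : S) (s t : dfield sc) (z w : dfield sc * dfield sc) :
  val (s * z.1 - t * w.1) * X1 + val (s * z.2 - t * w.2) * X2 =
  val s * (val z.1 * X1 + val z.2 * X2) - val t * (val w.1 * X1 + val w.2 * X2).
Proof.
rewrite !rmorphB !rmorphM !mulrBl !mulrDr !mulrA opprD !addrA; congr (_ + _).
by rewrite addrAC.
Qed.

Lemma dfield_vec_div (R : realType) (S : unitAlgType R[i]) (M : lmodType S)
    (rm : M -> S -> M) (d : S -> M) (sc : skew_calculus rm d)
    (X1 X2 : S) (c a b : dfield sc) : c != 0 ->
  val c * (val (a / c) * X1 + val (b / c) * X2) = val a * X1 + val b * X2.
Proof.
have E (a' : dfield sc) : c != 0 -> val c * val (a' / c) = val a'.
  by move=> c0; rewrite -rmorphM mulrC divfK.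
by move=> c0; rewrite mulrDr; congr (_ + _); rewrite mulrA; congr (_ * _); apply: E.
Qed.

Lemma map_scaled_prod_XsubC (A B : nzRingType) (f : {rmorphism A -> B}) n
    (c : A) (s : 'I_n -> A) :
  map_poly f (c%:P * \prod_(m < n) ('X - (s m)%:P)) =
  (f c)%:P * \prod_(m < n) ('X - (f (s m))%:P).
Proof.
rewrite rmorphM /= map_polyC rmorph_prod; congr (_ * _).
by apply: eq_bigr => m _; rewrite rmorphB /= map_polyX map_polyC.
Qed.

Lemma wedge_subr (A : comNzRingType) (a b p1 p2 q1 q2 s e : A) :
  (a * (p2 - s * q2) - b * (p1 - s * q1)) * e =
  (a * p2 - b * p1) * e - s * ((a * q2 - b * q1) * e).
Proof. by ring. Qed.

Lemma dfield_valV (R : realType) (S : unitAlgType R[i]) (M : lmodType S)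
    (rm : M -> S -> M) (d : S -> M) (sc : skew_calculus rm d) (c : dfield sc) :
  val (c^-1) = (val c)^-1.
Proof. exact: (fmorphV (val : {rmorphism dfield sc -> S})). Qed.

Theorem theorem23 (R : realType) (h : R[i]) (h_neq0 : h != 0)
    (disp : Order.disp_t) (I : orderType disp)
    (* H_I with the action of U_h(sl(2)) *)
    (H : algType R[i]) (x y : I -> H) (isH : is_HI h x y)
    (UH : Uh_module_algebra h H) (actH : is_HI_action x y UH)
    (* Q_I with the extended action *)
    (Q : unitAlgType R[i]) (j : {lrmorphism H -> Q})
    (isQ : right_quotient_skew_field j)
    (UQ : Uh_module_algebra h Q) (actQ : action_extends j UH UQ)
    (* the indices *)
    (o : I) (K : set I) (Ko : K o)
    (g s p q : nat) (g_ge1 : (1 <= g)%N) (s_le : (s <= 2 * g + 2)%N)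
    (pq : p%:Z - q%:Z = g%:Z + 1 - s%:Z)
    (i_ : 'I_(2 * g + 2) -> I) (j_ : 'I_(g - 1) -> I)
    (k_ : 'I_p -> I) (l_ : 'I_q -> I)
    (i_notK : forall m, ~ K (i_ m)) (j_notK : forall m, ~ K (j_ m))
    (k_K : forall m, K (k_ m)) (l_K : forall m, K (l_ m))
    (distinct : uniq (o :: codom i_ ++ codom k_ ++ codom l_)) :
  let r := abel_form h x y o s i_ k_ l_ in
  let k := (s + 2 * p)%N in
  is_form x y UH o k r /\
  forall
    (* the decomposition of r and the skew field Q_I^Sigma *)
    (QS : unitAlgType R[i]) (iota : {lrmorphism Q -> QS})
    (US : Uh_module_algebra h QS) (actS : action_extends iota UQ US)
    (a : I) (D : {linear H -> H}) (gam del : H) (u : 'I_k.+1 -> H)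
    (Sigma : fieldType) (kappa : {rmorphism Sigma -> QS})
    (sigma : 'I_k -> Sigma)
    (fact : factor_data x y UH o j UQ iota US r a D gam del u kappa sigma)
    (* the skew field Q_I^{Sigma,W} *)
    (QSW : unitAlgType R[i]) (iotaW : {lrmorphism QS -> QSW})
    (W : 'I_k -> QSW) (extW : central_skew_extension iotaW W),
  let xS i := iotaW (iota (j (x i))) in
  let yS i := iotaW (iota (j (y i))) in
  let X n := iotaW (coordX x j iota gam a (kappa (sigma n))) in
  let Y n := iotaW (coordY y j iota del a (kappa (sigma n))) in
  forall
    (W_sqr : forall n,
       W n ^+ 2 = \prod_m bracket h (X n) (Y n) (xS (i_ m)) (yS (i_ m)))
    (* the differential module of Q_I^{Sigma,W} *)
    (M : lmodType QSW) (rm : M -> QSW -> M) (d : QSW -> M)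
    (isM : is_differential_module h xS yS K
       [set t | (exists n, t = iotaW (kappa (sigma n))) \/ (exists n, t = W n)]
       rm d),
  exists eps : 'I_k -> bool,
    \sum_n (-1) ^+ eps n *:
      hyperelliptic_differential h rm d
        (fun m => xS (j_ m)) (fun m => yS (j_ m)) (W n) (X n) (Y n) = 0.
Proof.
move=> r k.
have [[io ko lo] ij ik il kl] := uniq_codomsP distinct.
have pq' : (p + s = q + g + 1)%N by lia.
have r0 : r != 0 by apply: (abel_form_neq0 isH s) => //; lia.
have rb : subalg (brackets h x y) r by apply: abel_form_brackets.
split.
  split=> //; first exact: (brackets_invariant isH actH).
  by apply: (abel_form_homog isH) => //; lia.
move=> QS iota US _ a D gam del u Sigma kappa sigma fact QSW iotaW W extW.
move=> xS yS X Y W_sqr M rm d isM.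
have [skW WC _] := extW.
have dr := dm_relations isM.
pose T : set QSW :=
  [set t | (exists n, t = iotaW (kappa (sigma n))) \/ (exists n, t = W n)].
pose psi : {lrmorphism H -> QSW} := iotaW \o (iota \o j).
have hp : hpoints h xS yS := hpoints_morph psi (HI_hpoints isH).
have gen := quotient_tower_ind isH isQ (fd_ext fact) extW.
have TC t z : T t -> t * z = z * t.
  case=> -[n ->]; last exact: WC.
  by apply: (central_extension_comm extW) => b; apply: (fd_Sigma_central fact).
have psi_inj : injective psi.
  have [skQ jinj _] := isQ; have [skS _ _] := fd_ext fact.
  by apply: inj_comp; [|apply: inj_comp => //]; apply: skew_field_morph_inj.
have br_neq0 i l : i != l -> bracket h (xS i) (yS i) (xS l) (yS l) != 0.
  move=> il'; rewrite -(bracket_morph h psi) raddf_eq0 //.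
  exact: (bracket_neq0 isH).
(* The base points are the first two of the [i_], hence outside [K]. *)
have lt1N : (1 < 2 * g + 2)%N by lia.
pose m1 : 'I_(2 * g + 2) := Ordinal lt1N.
pose m2 : 'I_(2 * g + 2) := Ordinal (ltnW lt1N).
have p12 : i_ m1 != i_ m2 by rewrite (inj_eq ij).
pose F := dfield (dr_calculus skW dr).
pose vx (z : F * F) := xvec (i_ m1) (i_ m2) z.
pose vy (z : F * F) := yvec (i_ m1) (i_ m2) z.
pose P := pt skW dr hp TC gen (i_ m1) (i_ m2).
pose w (z z' : F * F) : F := wedge hp TC gen (i_ m1) (i_ m2) z z'.
have vP i : vx (P i) = xS i /\ vy (P i) = yS i := pt_vec skW dr hp TC gen br_neq0 p12 i.
have vPx i : val (P i).1 * xS (i_ m1) + val (P i).2 * xS (i_ m2) = xS i by case: (vP i).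
have vPy i : val (P i).1 * yS (i_ m1) + val (P i).2 * yS (i_ m2) = yS i by case: (vP i).
have wE z z' : bracket h (vx z) (vy z) (vx z') (vy z') = val (w z z').
  exact: bracket_vec.
have psi_dc b : subalg (brackets h x y) b -> psi b \in dcentral (dr_calculus skW dr).
  apply: brackets_dcentral => [i l|c]; last first.
    by rewrite (dr_scale dr) (calculus_d1 (dr_calculus skW dr)) scaler0.
  by rewrite bracket_morph; apply: (bracket_dcentral skW dr hp TC gen).
have isD := fd_D fact; have k0 := fd_n_gt0 fact.
pose fa : F := DField (psi_dc _ (brackets_polar isD k k rb)).
pose xi : F := DField (psi_dc _ (brackets_polar isD k k.-1 rb)).
have sT n : T (iotaW (kappa (sigma n))) by left; exists n.
have WT n : T (W n) by right; exists n.
pose sF n : F := DField (central_dcentral skW dr TC (sT n)).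
pose WF n : F := DField (central_dcentral skW dr TC (WT n)).
have fa0 : fa != 0.
  have : psi (polar D k k r) != 0; last by apply: contra_neq => /(congr1 val) E; apply: E.
  rewrite raddf_eq0 //.
  by apply: contraNneq (fact_fa_neq0 isQ r0 fact) => ->; rewrite rmorph0.
have eta0 : w (P o) (P a) != 0.
  by apply: wedge_pt_neq0 => //; rewrite eq_sym; apply: fd_a_neq0 fact.
have etaE : val (w (P o) (P a)) = bracket h (xS o) (yS o) (xS a) (yS a).
  by rewrite -wE; have [-> ->] := vP o; have [-> ->] := vP a.
pose eta := w (P o) (P a).
(* Coordinates of the pair (gamma, delta). Cramer's rule for the brackets [xi] with [p_0] and [fa]
   with [p_a] shows that [eta] times the pair is [xi p_a - fa p_0]. *)
pose zg : F * F :=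
  ((xi * (P a).1 - fa * (P o).1) / eta, (xi * (P a).2 - fa * (P o).2) / eta).
have faE : val fa = bracket h (xS a) (yS a) (psi gam) (psi del).
  transitivity (psi (bracket h (x a) (y a) gam del)); last exact: bracket_morph.
  by rewrite -(fact_polar_top fact).
have xiE : val xi = bracket h (xS o) (yS o) (psi gam) (psi del).
  transitivity (psi (bracket h (x o) (y o) gam del)); last exact: bracket_morph.
  by rewrite -(fd_xi fact).
have etaU : val eta \is a GRing.unit by apply: (@skW); rewrite raddf_eq0 //; apply: val_inj.
have zgE : vx zg = psi gam /\ vy zg = psi del.
  have sol_y := bracket_solve_y hp o a (psi gam) (psi del).
  have sol_x := bracket_solve_x hp o a (psi gam) (psi del).
  split; apply: (mulrI etaU).
  - rewrite [LHS]dfield_vec_div // dfield_vecB !vPx.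
    by rewrite etaE sol_x -faE -xiE -!dfieldC.
  - rewrite [LHS]dfield_vec_div // dfield_vecB !vPy.
    by rewrite etaE sol_y -faE -xiE -!dfieldC.
pose zs n : F * F := (zg.1 - sF n * (P a).1, zg.2 - sF n * (P a).2).
have zsE n : vx (zs n) = X n /\ vy (zs n) = Y n.
  have E (X1 X2 : QSW) : val (zs n).1 * X1 + val (zs n).2 * X2 =
      (val zg.1 * X1 + val zg.2 * X2) - val (sF n) * (val (P a).1 * X1 + val (P a).2 * X2).
    by have := dfield_vecB X1 X2 1 (sF n) zg (P a); rewrite !mul1r.
  rewrite /vx /vy /xvec /yvec !E.
  have gx : val zg.1 * xS (i_ m1) + val zg.2 * xS (i_ m2) = psi gam by case: zgE.
  have gy : val zg.1 * yS (i_ m1) + val zg.2 * yS (i_ m2) = psi del by case: zgE.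
  rewrite vPx vPy gx gy.
  by split; rewrite /X /Y /coordX /coordY rmorphB rmorphM.
pose C : F := fa ^- k.-1.
pose q' := \prod_(m < k) ('X - (sF m)%:P).
(* Comparing coefficients in the splitting expresses each [u_i] through the coefficients of the
   product of the ['X - sigma_m], so its image also lies in [F]. *)
have uE i : psi (u i) = val (fa ^+ k * (C * q'`_(k - i))).
  have fU : j (polar D k k r) \is a GRing.unit.
    by have [skQ _ _] := isQ; apply: (skQ _ (fact_fa_neq0 isQ r0 fact)).
  have pX n : iotaW (iota (j (polar D k k r) ^- n)) = val fa ^- n.
    by rewrite !rmorphV ?rmorph_unit ?unitrX // !rmorphXn.
  have valC : val C = val fa ^- k.-1 
    by rewrite /C dfield_valV rmorphXn.
  have E : val fa ^- k * psi (u i) = val (C * q'`_(k - i)).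
    rewrite -(pX k); transitivity (iotaW (iota (j (polar D k k r) ^- k * j (u i)))).
      by rewrite !rmorphM.
    rewrite (fact_coef fact) -coef_map map_scaled_prod_XsubC.
    rewrite [X in X%:P * _](pX k.-1) -valC -coefCM -coef_map.
    by rewrite (map_scaled_prod_XsubC _ C sF).
  have fkU : val fa ^+ k \is a GRing.unit.
    by apply: unitrX; apply: (@skW); apply: contra_neq fa0 => E0; apply: val_inj.
  rewrite -[LHS](mulVKr fkU) E; apply: esym; rewrite rmorphM; congr (_ * _).
  exact: rmorphXn.
(* Specialising [x_o, y_o] to the point [z] is an algebra morphism fixing
   [H_{I\{0}}]; it turns the expansion of [r] in [xi], [eta] into the
   factorisation of the form at [z]. *)
have formE z : form_at hp TC gen (i_ m1) (i_ m2) s i_ k_ l_ z = C * \prod_n w z (zs n).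
  have [_ _ univ] := isH.
  pose pc c := if c == o then z else P c.
  have pcP c : c != o -> vx (pc c) = xS c /\ vy (pc c) = yS c.
    by rewrite /pc => /negPf ->.
  have /HI_relationsP rel : hpoints h (fun c => vx (pc c)) (fun c => vy (pc c)).
    by move=> c c'; apply: vec_hpoints.
  have [phi phiE] := univ _ _ _ rel.
  have phio : phi (x o) = vx z /\ phi (y o) = vy z.
    by have [-> ->] := phiE o; rewrite /pc eqxx.
  have phi_psi b : HJ x y (~` [set o]) b -> phi b = psi b.
    apply: subalg_lrmorph => b' [c /eqP co]; have [xc yc] := pcP c co.
    by case=> ->; [rewrite (phiE c).1 xc|rewrite (phiE c).2 yc].
  have phi_br c : c != o -> phi (bracket h (x o) (y o) (x c) (y c)) = val (w z (P c)).
    move=> co; rewrite bracket_morph; have [-> ->] := phio; have [-> ->] := phiE c.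
    by rewrite -wE /pc (negPf co).
  have phi_r : phi r = val (form_at hp TC gen (i_ m1) (i_ m2) s i_ k_ l_ z).
    rewrite abel_form_morph /form_at rmorphB !rmorphM !rmorph_prod.
    congr (_ * (_ * _) - _ * (_ * _)); apply: eq_bigr => m _; exact: phi_br.
  have zsw m : w z (zs m) = w z zg - sF m * w z (P a) by apply: wedge_subr.
  have fak0 : fa ^+ k != 0 by rewrite expf_neq0.
  apply: (mulfI fak0); apply: val_inj.
  have phi_fa : phi (polar D k k r) = val fa.
    rewrite faE (fact_polar_top fact) bracket_morph.
    have [-> ->] := phiE a; have [-> ->] := pcP a (fd_a_neq0 fact).
    by rewrite (phi_psi _ (fd_gam fact)) (phi_psi _ (fd_del fact)).
  have phi_xi : phi (bracket h (x o) (y o) gam del) = val (w z zg).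
    rewrite bracket_morph (phi_psi _ (fd_gam fact)) (phi_psi _ (fd_del fact)).
    by rewrite -wE; have [-> ->] := zgE; have [-> ->] := phio.
  have LE : val (fa ^+ k * form_at hp TC gen (i_ m1) (i_ m2) s i_ k_ l_ z) =
      phi (polar D k k r ^+ k * r).
    transitivity (phi (polar D k k r) ^+ k * phi r); last by rewrite rmorphM rmorphXn.
    by rewrite phi_fa phi_r [LHS]rmorphM; congr (_ * _); apply: rmorphXn.
  have RE : fa ^+ k * (C * \prod_m w z (zs m)) = \sum_(i < k.+1)
      w z zg ^+ (k - i) * w z (P a) ^+ i * (fa ^+ k * (C * q'`_(k - i))).
    rewrite (eq_bigr _ (fun m _ => zsw m)) -homogeneous_prod_XsubC !mulr_sumr.
    apply: eq_bigr => i _; rewrite !mulrA -/q'; move: (fa ^+ k) (C) (q'`_ _) => c1 c2 c3.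
    by move: (_ ^+ _) (_ ^+ _) => c4 c5; ring.
  apply: (etrans LE); rewrite (fact_expansion isQ r0 fact) RE rmorph_sum [RHS]rmorph_sum.
  apply: eq_bigr => i _; apply: etrans (rmorphM phi _ _) _.
  rewrite [RHS]rmorphM; congr (_ * _);
    last exact: etrans (phi_psi _ (fd_u fact i).1) (uE i).
  apply: etrans (rmorphM phi _ _) _; rewrite [RHS]rmorphM; congr (_ * _).
    by rewrite [LHS]rmorphXn [RHS]rmorphXn; congr (_ ^+ _); apply: phi_xi.
  rewrite [LHS]rmorphXn [RHS]rmorphXn; congr (_ ^+ _).
  exact: phi_br _ (fd_a_neq0 fact).
have WF_sqr n : WF n ^+ 2 = \prod_m w (zs n) (P (i_ m)).
  apply: val_inj; rewrite rmorphXn rmorph_prod; apply: (etrans (W_sqr n)).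
  apply: eq_bigr => m _; have [xn yn] := zsE n; rewrite -xn -yn.
  by have [xm ym] := vP (i_ m); rewrite -{1}xm -{1}ym; apply: wE.
have kE : k = (s + 2 * p)%N by [].
have [eps epsE] := abel_hyperelliptic_sum br_neq0 p12 j_ ij ik il kl i_notK
  g_ge1 (erefl _) pq' (erefl _) (erefl _) kE formE WF_sqr.
exists eps; rewrite -[RHS]epsE; apply: eq_bigr => n _.
by have [xE yE] := zsE n; rewrite -xE -yE.
Qed.
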